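(* Let $0<\gamma\le 1$. For each $H\in\mathscr{H}$ there exists $C>0$ such that for every $r>0$ and every $f\in(\mathcal{C}^{0,\gamma}\cap L^\infty)(\mathbb{R}^n)$ $$\|u(H_r,f)-u\|_{L^\infty(\mathbb{R}^{n+1}_+)}\le C[f]_\gamma\,r^\gamma,$$ where $H_r(x,t)=\frac{1}{r^{n+2}}H\left(\frac{x}{r},\frac{t}{r^2}\right)$, $u(H_r,f)$ is the solution of problem $P(H_r,f)$, and $u$ is the temperature in $\mathbb{R}^{n+1}_+$ given by $u(x,t)=(\mathcal{W}(\cdot,t)\ast f)(x)$.
   Context: $\mathbb{R}^{n+1}_+=\{(x,t):x\in\mathbb{R}^n,\ t\ge 0\}$. $\mathcal{C}^{0,\gamma}(\mathbb{R}^n)$ is the space of Lipschitz functions of order $\gamma$, with seminorm $[f]_\gamma=\sup_{x\ne y}\frac{|f(x)-f(y)|}{|x-y|^\gamma}$. $\mathcal{W}(x,t)=(4\pi t)^{-n/2}e^{-|x|^2/(4t)}$ for $t>0$, $x\in\mathbb{R}^n$, is the Weierstrass kernel; the convolution $\mathcal{W}(\cdot,t)\ast f$ is in $\mathbb{R}^n$, and at $t=0$ one sets $u(x,0)=f(x)$. Problem $P(J,f)$: find $u$ on $\mathbb{R}^{n+1}_+$ such that for all $x\in\mathbb{R}^n$, $t\ge 0$, $u(x,t)=\iint_{\mathbb{R}^{n+1}}J(x-y,t-s)\overline{u}(y,s)\,dy\,ds$, where $\overline{u}(x,t)=f(x)$ for $t<0$ and $\overline{u}(x,t)=u(x,t)$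 for $t\ge 0$. Its solution $u(J,f)$ is the unique one in the class of bounded continuous functions on $\mathbb{R}^{n+1}_+$ (it exists and is unique whenever $f\in L^\infty(\mathbb{R}^n)$, $J\ge 0$, $\iint J=1$, and $J$ has compact support contained in $\mathbb{R}^{n+1}_+$). $\mathscr{H}$ is the class of parabolic mean value kernels, i.e. the functions $H:\mathbb{R}^{n+1}\to\mathbb{R}$ such that: $\operatorname{supp}H\subset\mathbb{R}^{n+1}_+$; $H\ge 0$; $H\in L^1(\mathbb{R}^{n+1})$ with $\iint H\,dx\,dt=1$; $H$ has compact support in $\mathbb{R}^{n+1}$; for each $t$ the function $x\mapsto H(x,t)$ is radial; and $H$ satisfies the mean value formula for temperatures: if $v$ is a solution of the heat equation $\frac{\partial v}{\partial t}=\triangle v$ in a domain $\Omega\subset\mathbb{R}^{n+1}$, then for each $(x,t)\in\Omega$ and all $r>0$ small enough (in particular so small that the support of $(y,s)\mapsto H_r(x-y,t-s)$ is contained in $\Omega$), $$v(x,t)=\iint H_r(x-y,t-s)\,v(y,s)\,dy\,ds.$$ An example is $\mathcal{H}(x,t)=\frac14\mathcal{X}_E(x,t)\frac{|x|^2}{t^2}$ with $E=\{(x,t):t>0,\ \mathcal{W}(x,t)\ge 1\}$, where $\mathcal{X}_E$ is the indicator function of $E$. *)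

(* Defs.v *)
From HB Require Import structures.
From mathcomp Require Import all_boot all_order all_algebra.
From mathcomp Require Import all_classical all_reals all_analysis.

Set Implicit Arguments.
Unset Strict Implicit.
Unset Printing Implicit Defensive.
Import Order.TTheory GRing.Theory Num.Theory.
Import numFieldNormedType.Exports.

Local Open Scope classical_set_scope.
Local Open Scope ring_scope.

Definition rV_display : measure_display. Proof. by constructor. Qed.

Section measurable_rV.
Context {R : realType} (n : nat).

Definition rV_coord (i : 'I_n) (x : 'rV[R]_n) : measurableTypeR R := x ord0 i.

Let rV_set0 : g_sigma_preimage rV_coord set0.
Proof. exact: sigma_algebra0. Qed.

Let rV_setC A : g_sigma_preimage rV_coord A -> g_sigma_preimage rV_coord (~` A).
Proof. exact: sigma_algebraC. Qed.

Let rV_bigcup (F : _^nat) : (forall i, g_sigma_preimage rV_coord (F i)) ->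
  g_sigma_preimage rV_coord (\bigcup_i (F i)).
Proof. exact: sigma_algebra_bigcup. Qed.

HB.instance Definition _ := @isMeasurable.Build rV_display 'rV[R]_n
  (g_sigma_preimage rV_coord) rV_set0 rV_setC rV_bigcup.

End measurable_rV.

Section measurable_rV_theory.
Context {R : realType}.

Lemma measurable_rV_coord n (i : 'I_n) :
  measurable_fun [set: 'rV[R]_n] (rV_coord i).
Proof.
move=> _ Y mY; rewrite setTI; apply: sub_sigma_algebra => /=.
rewrite -bigcup_seq/=; exists i => /=; first by rewrite mem_index_enum.
by exists Y => //; rewrite setTI.
Qed.

Lemma measurable_fun_rVP d (T : measurableType d) n (f : T -> 'rV[R]_n) :
  measurable_fun [set: T] f <->
  forall i, measurable_fun [set: T] (rV_coord i \o f).
Proof.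
split=> [mf i|mf].
  by apply: measurableT_comp => //; exact: measurable_rV_coord.
move=> _ A mA; rewrite setTI.
have : preimage_set_system [set: T] f (g_sigma_preimage (@rV_coord R n))
    (f @^-1` A) by exists A => //; rewrite setTI.
rewrite -g_sigma_preimage_comp; apply: smallest_sub => [|B].
  exact: sigma_algebra_measurable.
by rewrite -bigcup_seq/= => -[i _ [C mC <-]]; exact: mf.
Qed.

Definition cons_rV n (p : measurableTypeR R * 'rV[R]_n) : 'rV[R]_n.+1 :=
  \row_i (if unlift ord0 i is Some j then p.2 ord0 j else p.1).

Definition uncons_rV n (x : 'rV[R]_n.+1) : measurableTypeR R * 'rV[R]_n :=
  (x ord0 ord0, \row_i x ord0 (lift ord0 i)).

Lemma cons_rVK n : cancel (@cons_rV n) (@uncons_rV n).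
Proof.
move=> [a y]; rewrite /uncons_rV mxE unlift_none; congr pair.
by apply/rowP => i; rewrite !mxE liftK.
Qed.

Lemma measurable_cons_rV n : measurable_fun setT (@cons_rV n).
Proof.
apply/measurable_fun_rVP => i.
case: (unliftP ord0 i) => [j ->|->].
  rewrite [X in measurable_fun _ X](_ : _ = rV_coord j \o snd).
    exact: (measurableT_comp (measurable_rV_coord j)).
  by apply/funext => p; rewrite /rV_coord /= mxE liftK.
rewrite [X in measurable_fun _ X](_ : _ = fst)//.
by apply/funext => p; rewrite /rV_coord /= mxE unlift_none.
Qed.

Lemma measurable_uncons_rV n : measurable_fun setT (@uncons_rV n).
Proof.
apply/measurable_fun_pairP; split; first exact: measurable_rV_coord.
apply/measurable_fun_rVP => i.
rewrite [X in measurable_fun _ X](_ : _ = rV_coord (lift ord0 i)).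
  exact: measurable_rV_coord.
by apply/funext => x; rewrite /rV_coord /= mxE.
Qed.

End measurable_rV_theory.

(* Canonical inference no longer finds this for a general `m1 \x m2`: the
   instance for products of subprobabilities takes precedence. *)
Lemma product_sigma_finite d1 d2 (T1 : measurableType d1)
    (T2 : measurableType d2) (R : realType)
    (m1 : {sigma_finite_measure set T1 -> \bar R})
    (m2 : {sigma_finite_measure set T2 -> \bar R}) :
  sigma_finite setT (m1 \x m2)%E.
Proof.
have /sigma_finiteP[F [TF ndF Foo]] := sigma_finiteT m1.
have /sigma_finiteP[G [TG ndG Goo]] := sigma_finiteT m2.
exists (fun n => F n `*` G n).
  rewrite -setXTT TF TG predeqE => -[x y]; split.
    move=> [/= [n _ Fnx] [k _ Gky]]; exists (maxn n k) => //; split.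
    - by move: x Fnx; exact/subsetPset/ndF/leq_maxl.
    - by move: y Gky; exact/subsetPset/ndG/leq_maxr.
  by move=> [n _ []/= ? ?]; split; exists n.
move=> k; have [? ?] := Foo k; have [? ?] := Goo k.
split; first exact: measurableX.
by rewrite product_measure1E// lte_mul_pinfty// ge0_fin_numE.
Qed.

Section lebesgue_rV_step.
Context {R : realType} n (mu : {sigma_finite_measure set 'rV[R]_n -> \bar R}).
Local Open Scope ereal_scope.

Definition lebesgue_cons : set 'rV[R]_n.+1 -> \bar R :=
  pushforward (@lebesgue_measure R \x mu) (@cons_rV R n).

Let pushM : {measure set 'rV[R]_n.+1 -> \bar R} :=
  measure_function_pushforward__canonical__measure_function_Measure
    (@lebesgue_measure R \x mu) (@measurable_cons_rV R n).

Let lebesgue_cons0 : lebesgue_cons set0 = 0.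
Proof. exact: (measure0 pushM). Qed.

Let lebesgue_cons_ge0 A : 0 <= lebesgue_cons A.
Proof. exact: (measure_ge0 pushM). Qed.

Let lebesgue_cons_sigma_additive : semi_sigma_additive lebesgue_cons.
Proof. exact: (@measure_semi_sigma_additive _ _ _ pushM). Qed.

HB.instance Definition _ := isMeasure.Build _ _ _ lebesgue_cons
  lebesgue_cons0 lebesgue_cons_ge0 lebesgue_cons_sigma_additive.

Let lebesgue_cons_sigma_finite : sigma_finite setT lebesgue_cons.
Proof.
have [F TF Foo] := product_sigma_finite (@lebesgue_measure R) mu.
exists (fun k => @uncons_rV R n @^-1` F k).
  by rewrite -preimage_bigcup -TF preimage_setT.
move=> k; have [mF Fk] := Foo k; split.
  by rewrite -[X in measurable X]setTI; exact: measurable_uncons_rV.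
rewrite /lebesgue_cons /pushforward -comp_preimage.
rewrite (_ : _ \o _ = id) ?preimage_id//.
by apply/funext => p /=; rewrite cons_rVK.
Qed.

HB.instance Definition _ := Measure_isSigmaFinite.Build _ _ _ lebesgue_cons
  lebesgue_cons_sigma_finite.

End lebesgue_rV_step.

Section lebesgue_rV.
Context {R : realType}.
Local Open Scope ereal_scope.

(* Lebesgue measure on the product sigma-algebra of R^n, i.e. on its Borel
   sets; lebesgue_rV_box gives the value on boxes, which determines it. *)
Fixpoint lebesgue_rV n : {sigma_finite_measure set 'rV[R]_n -> \bar R} :=
  if n is m.+1 then lebesgue_cons (lebesgue_rV m) else \d_(0%R : 'rV[R]_0).

Lemma measurable_rV_box n (A : 'I_n -> set (measurableTypeR R)) :
  (forall i, measurable (A i)) ->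
  measurable [set x : 'rV[R]_n | forall i, A i (x ord0 i)].
Proof.
move=> mA.
rewrite (_ : mkset _ = \bigcap_(i in [set: 'I_n]) (rV_coord i @^-1` A i)).
  apply: fin_bigcap_measurable => // i _.
  by rewrite -[X in measurable X]setTI; exact: measurable_rV_coord.
by apply/seteqP; split => x /= xA i; [move=> _|]; exact: xA.
Qed.

Lemma lebesgue_rV_box n (A : 'I_n -> set (measurableTypeR R)) :
  (forall i, measurable (A i)) ->
  lebesgue_rV n [set x | forall i, A i (x ord0 i)] =
  \prod_(i < n) lebesgue_measure (A i).
Proof.
elim: n A => [|n IHn] A mA.
  rewrite big_ord0 /= diracE mem_set//= => i; by case: i.
rewrite big_ord_recl -IHn => [|i]; last exact: mA.
rewrite -(product_measure1E (@lebesgue_measure R) (lebesgue_rV n));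
  [|exact: mA|by apply: (measurable_rV_box (A := fun j => A (lift ord0 j)))].
rewrite /= /lebesgue_cons /pushforward.
congr (_ \x _); apply/seteqP; split => [[a y] /= ay|[a y] [/= a0 yA] i].
  split => /=; first by have := ay ord0; rewrite mxE unlift_none.
  by move=> i; have := ay (lift ord0 i); rewrite mxE liftK.
by rewrite mxE; case: unliftP => [j ->|->].
Qed.

Definition spacetime_measure n :
    {measure set ('rV[R]_n * measurableTypeR R)%type -> \bar R} :=
  lebesgue_rV n \x @lebesgue_measure R.

End lebesgue_rV.

Section temperatures.
Context {R : realType} {n : nat}.
Local Notation spacetime := ('rV[R]_n * R)%type.
Implicit Types (x y : 'rV[R]_n) (z w : spacetime) (Omega : set spacetime).
Implicit Types (f : 'rV[R]_n -> R) (u v H J : spacetime -> R).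

Local Notation mu := (@spacetime_measure R n).

Definition halfspace : set spacetime := [set z | 0 <= z.2].

Definition halfspace_Linfty u : \bar R :=
  ('N[mu]_(+oo) [EFin \o (u \_ halfspace)%R])%E.

(* The norm `|x| of the library is the maximum norm. *)
Definition enorm x : R := Num.sqrt (\sum_i x ord0 i ^+ 2).

Definition holder_seminorm (gamma : R) f : \bar R :=
  ereal_sup [set (`|f p.1 - f p.2| / enorm (p.1 - p.2) `^ gamma)%:E |
             p in [set p : 'rV[R]_n * 'rV[R]_n | p.1 != p.2]].

Definition holder_continuous (gamma : R) f : Prop :=
  (holder_seminorm gamma f < +oo)%E.

(* The library's `integrable` demands Borel measurability; Lebesgue integrable
   functions are those equal almost everywhere to a Borel integrable one. The
   library's integral, being defined for all functions by approximation from
   below of the positive and negative parts by Borel simple functions, does not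
   change under modification on a null set, so that it agrees with the Lebesgue
   integral on these functions. *)
Definition lebesgue_integrable H : Prop :=
  exists2 g : spacetime -> R,
    mu.-integrable setT (EFin \o g) & {ae mu, forall z, H z = g z}.

Definition spacetime_conv J v z : R :=
  Rintegral mu setT (fun w : spacetime => J (z - w) * v w).

Definition supp H : set spacetime := closure [set z | H z != 0].

Definition parabolic_scale (r : R) H : spacetime -> R :=
  fun z => (r ^+ (n + 2))^-1 * H (r^-1 *: z.1, z.2 / r ^+ 2).

Definition e_x (i : 'I_n) : spacetime := (delta_mx ord0 i, 0).
Definition e_t : spacetime := (0, 1).

Definition C21 Omega v : Prop :=
  forall z, Omega z ->
  [/\ {for z, continuous v},
      derivable v z e_t /\ {for z, continuous ('D_e_t v)},
      forall i, derivable v z (e_x i) /\ {for z, continuous ('D_(e_x i) v)} &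
      forall i j, derivable ('D_(e_x i) v) z (e_x j) /\
                  {for z, continuous ('D_(e_x j) ('D_(e_x i) v))}].

Definition heat_solution Omega v : Prop :=
  C21 Omega v /\
  forall z, Omega z -> 'D_e_t v z = \sum_i 'D_(e_x i) ('D_(e_x i) v) z.

(* v is a total function whose values off Omega play no role: for small r they
   are multiplied by 0 in the integral. *)
Definition mean_value_formula H : Prop :=
  forall Omega v, open Omega -> connected Omega -> heat_solution Omega v ->
  forall z, Omega z -> \forall r \near 0^'+,
    supp (fun w => parabolic_scale r H (z - w)) `<=` Omega /\
    v z = spacetime_conv (parabolic_scale r H) v z.

Record mean_value_kernel H : Prop := {
  mvk_supp : supp H `<=` halfspace ;
  mvk_ge0 : forall z, 0 <= H z ;
  mvk_integrable : lebesgue_integrable H ;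
  mvk_int1 : Rintegral mu setT H = 1 ;
  mvk_compact : compact (supp H) ;
  mvk_radial : forall t x y, enorm x = enorm y -> H (x, t) = H (y, t) ;
  mvk_mean_value : mean_value_formula H }.

Definition past_extension f u : spacetime -> R :=
  fun z => if z.2 < 0 then f z.1 else u z.

(* Only the values of u on halfspace matter. *)
Definition is_nonlocal_solution J f u : Prop :=
  [/\ [bounded u z | z in halfspace],
      {within halfspace, continuous u} &
      forall z, halfspace z -> u z = spacetime_conv J (past_extension f u) z].

Definition weierstrass x (t : R) : R :=
  (4 * pi * t) `^ (- (n%:R / 2)) * expR (- (enorm x ^+ 2 / (4 * t))).

Definition temperature f : spacetime -> R :=
  fun z => if z.2 == 0 then f z.1
           else Rintegral (lebesgue_rV n) setT
                  (fun y => weierstrass (z.1 - y) z.2 * f y).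

End temperatures.

(* Main.v *)
Require Import Defs.
From HB Require Import structures.
From mathcomp Require Import all_boot all_order all_algebra.
From mathcomp Require Import all_classical all_reals all_analysis.
From mathcomp Require Import measurable_realfun ess_sup_inf zify ring lra.

Set Implicit Arguments.
Unset Strict Implicit.
Unset Printing Implicit Defensive.
Import Order.TTheory GRing.Theory Num.Theory.
Import numFieldNormedType.Exports.

Local Open Scope classical_set_scope.
Local Open Scope ring_scope.

(** Let [u] be the temperature with initial datum [f], let [w] solve the
    nonlocal problem with kernel [H_r], and let [L] be the Hölder seminorm of
    [f].  Averaging against [H_r] reproduces [u] exactly at every point whose
    whole backward average lies in positive times, that is for [t > T r^2] when
    the kernel lives in [0 <= t <= T].  There [w - u] equals its own average,
    and a comparison principle bounds it by its values in the initial strip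
    [t <= (T + 1) r^2].  In that strip both [w] and [u] differ from [f] by
    [O(L r^gamma)]: [u] because the Weierstrass kernel has width [sqrt t]
    (temperature_near_datum), [w] because one average moves [f] by
    [O(L r^gamma)] and the comparison principle sums the errors made over the
    [O(1)] averages that the strip allows (nonlocal_near_datum).

    The comparison principle (comparison) rests on the weight [exp (t / r^2)],
    which averaging against [H_r] multiplies by [theta], the integral of
    [H (y, s) exp (- s)].  Since the kernel lives in nonnegative times and a
    single time slice is null, [theta < 1]; iterating the inequality that a
    subsolution satisfies therefore makes it as small as desired.

    The delicate point is the exact reproduction of [u] at a prescribed scale
    [r], because the mean value formula holds only for [r] below a threshold
    that depends on the temperature and on the point.  Apply it to the
    temperature [exp (xi . x + |xi|^2 t)] at the origin: the average over the
    scale [r] is, as [H] has compact support, a power series in [r], and it is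
    constant for small [r], so each coefficient of positive degree vanishes.
    These coefficients are the integrals of [H] against the homogeneous heat
    polynomials.  Replacing [xi] by [i xi] multiplies the coefficient of degree
    [k] by [i ^ k], so that vanishing persists (imaginary_continuation), and
    averaging reproduces [exp (- |xi|^2 t) cos (xi . x)] at every scale
    (kernel_fourier).  The Weierstrass kernel is a superposition of these
    functions (weierstrass_fourier), whence Fubini extends the reproduction
    property to it and then to [u] (kernel_weierstrass, kernel_temperature).
    The Fourier transform of the Gaussian comes from the same continuation
    argument, applied to the real exponential moments obtained by completing
    the square.

    Averages are handled on one fixed kernel: the substitution
    [w |-> (x - r y, t - r^2 s)] moves the scale from the kernel to the
    averaged function (spacetime_conv_scale), and [H], which is only Lebesgue
    integrable, is replaced there by a nonnegative compactly supported Borel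
    function equal to it almost everywhere (mean_value_kernel_borel). *)

(** * Integrals of real functions, and null sets *)

Section ae_integral.
Local Open Scope ereal_scope.
Context d (T : measurableType d) (R : realType) (mu : {measure set T -> \bar R}).
Import HBNNSimple.

Let nnintegral (f : T -> \bar R) := ereal_sup [set sintegral mu h |
  h in [set h : {nnsfun T >-> R} | forall x, (h x)%:E <= f x]].

Lemma nnintegral_le_ae (f g : T -> \bar R) : (forall x, 0 <= g x) ->
  {ae mu, forall x, f x = g x} -> nnintegral f <= nnintegral g.
Proof.
move=> g0 [N [mN N0 fgN]].
apply: ge_ereal_sup => _ [h /= hf <-].
have mNC := measurableC mN.
have -> : sintegral mu h = sintegral mu (@proj_nnsfun _ _ _ h _ mNC).
  rewrite -!integralT_nnsfun; apply: ae_eq_integral => //.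
  - by apply/measurable_EFinP; exact: measurable_funPT.
  - by apply/measurable_EFinP; exact: measurable_funPT.
  exists N; split => // x /=; apply: contra_notP => Nx.
  by move=> _; rewrite mindicE mem_set// mulr1.
apply: ereal_sup_ubound => /=.
exists (@proj_nnsfun _ _ _ h _ mNC) => // x /=; rewrite mindicE.
have [xN|xN] := boolP (x \in ~` N); last by rewrite mulr0.
rewrite mulr1; have <- // : f x = g x.
by apply: contrapT => fgx; move: xN; rewrite inE; apply; exact: fgN.
Qed.

(** Holds for arbitrary functions: the integral of a nonnegative function is a
    supremum over the simple functions below it, and a simple function keeps
    its integral when it is cut off on a measurable null set.  A kernel that is
    only Lebesgue measurable can thus be exchanged for a Borel one. *)
Lemma integral_eq_ae (f g : T -> \bar R) :
  {ae mu, forall x, f x = g x} -> \int[mu]_x f x = \int[mu]_x g x.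
Proof.
have ge0 (a b : T -> \bar R) : (forall x, 0 <= a x) -> (forall x, 0 <= b x) ->
    {ae mu, forall x, a x = b x} -> \int[mu]_x a x = \int[mu]_x b x.
  move=> a0 b0 ab; rewrite !ge0_integralTE//; apply/eqP; rewrite eq_le.
  rewrite !nnintegral_le_ae//.
  by apply: filterS ab => x ->.
move=> fg; rewrite integralE [RHS]integralE; congr (_ - _); apply: ge0 => //.
- by apply: filterS fg => x fgx; rewrite !funeposE fgx.
- by apply: filterS fg => x fgx; rewrite !funenegE fgx.
Qed.

End ae_integral.

Section real_integrals.
Context d (T : measurableType d) {R : realType} (mu : {measure set T -> \bar R}).
Implicit Types f g : T -> R.

Lemma dominated_integrable f g : measurable_fun setT f ->
  mu.-integrable setT (EFin \o g) -> (forall w, `|f w| <= g w) ->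
  mu.-integrable setT (EFin \o f).
Proof.
move=> mf ig fg; apply: (le_integrable measurableT _ _ ig) => //; first exact/measurable_EFinP.
by move=> w _ /=; rewrite lee_fin (le_trans (fg w))// ler_norm.
Qed.

Lemma integrable_addr f g : mu.-integrable setT (EFin \o f) ->
  mu.-integrable setT (EFin \o g) ->
  mu.-integrable setT (EFin \o (fun w => f w + g w)).
Proof. by move=> mf mg; exact: (integrableD measurableT mf mg). Qed.

Lemma integrable_subr f g : mu.-integrable setT (EFin \o f) ->
  mu.-integrable setT (EFin \o g) ->
  mu.-integrable setT (EFin \o (fun w => f w - g w)).
Proof. by move=> mf mg; exact: (integrableB measurableT mf mg). Qed.

Lemma integrable_scaler k f : mu.-integrable setT (EFin \o f) ->
  mu.-integrable setT (EFin \o (fun w => k * f w)).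
Proof. by move=> mf; exact: (integrableZl measurableT k mf). Qed.

Lemma integrable_sumr (I : Type) (s : seq I) (P : pred I) (F : I -> T -> R) :
  (forall i, P i -> mu.-integrable setT (EFin \o F i)) ->
  mu.-integrable setT (EFin \o (fun w => \sum_(i <- s | P i) F i w)).
Proof.
move=> iF; elim: s => [|i s IHs].
  rewrite (_ : _ \o _ = cst 0%E); first exact: integrable0.
  by apply/funext => w /=; rewrite big_nil.
rewrite (_ : _ \o _ = EFin \o (fun w => (if P i then F i w else 0) +
  \sum_(i <- s | P i) F i w)); last first.
  by apply/funext => w /=; rewrite big_cons; case: ifP; rewrite ?add0r.
apply: integrable_addr IHs.
by move: (iF i); case: (P i) => iFi; [exact: iFi|exact: integrable0].
Qed.

Lemma Rintegral_sumr (I : Type) (s : seq I) (P : pred I) (F : I -> T -> R) :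
  (forall i, P i -> mu.-integrable setT (EFin \o F i)) ->
  \int[mu]_w (\sum_(i <- s | P i) F i w) = \sum_(i <- s | P i) \int[mu]_w F i w.
Proof.
move=> iF; elim: s => [|i s IHs].
  rewrite big_nil; under eq_Rintegral do rewrite big_nil.
  by rewrite (Rintegral_cst mu measurableT) mul0r.
rewrite big_cons -IHs; under eq_Rintegral do rewrite big_cons.
case: ifP => Pi //; rewrite RintegralD//; [exact: iF|exact: integrable_sumr].
Qed.

End real_integrals.

Section real_fubini.
Context d1 d2 (T1 : measurableType d1) (T2 : measurableType d2) (R : realType).
Variable m1 : {sigma_finite_measure set T1 -> \bar R}.
Variable m2 : {sigma_finite_measure set T2 -> \bar R}.

(** Where the inner integral is infinite its real-valued version is 0, but that
    happens on a null set only. *)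
Lemma Rintegral_fubini1 (f : T1 * T2 -> R) :
  (m1 \x m2)%E.-integrable setT (EFin \o f) ->
  \int[m1]_x \int[m2]_y f (x, y) = \int[(m1 \x m2)%E]_z f z.
Proof.
move=> fi; rewrite /Rintegral -integral12_prod_meas1//; congr fine.
apply: integral_eq_ae; apply: filterS (ae_integrable1 fi) => x ix.
by rewrite fineK//; exact: (integrable_fin_num measurableT ix).
Qed.

Lemma Rintegral_fubini2 (f : T1 * T2 -> R) :
  (m1 \x m2)%E.-integrable setT (EFin \o f) ->
  \int[m2]_y \int[m1]_x f (x, y) = \int[(m1 \x m2)%E]_z f z.
Proof.
move=> fi; rewrite /Rintegral -integral21_prod_meas1//; congr fine.
apply: integral_eq_ae; apply: filterS (ae_integrable2 fi) => x ix.
by rewrite fineK//; exact: (integrable_fin_num measurableT ix).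
Qed.

Lemma Rintegral_exchange (f : T1 * T2 -> R) :
  (m1 \x m2)%E.-integrable setT (EFin \o f) ->
  \int[m1]_x \int[m2]_y f (x, y) = \int[m2]_y \int[m1]_x f (x, y).
Proof. by move=> fi; rewrite Rintegral_fubini1// Rintegral_fubini2. Qed.

Lemma integrable_Rintegral1 (f : T1 * T2 -> R) :
  (m1 \x m2)%E.-integrable setT (EFin \o f) ->
  m1.-integrable setT (EFin \o (fun x => \int[m2]_y f (x, y))).
Proof.
move=> fi; have iF := integrable_fubini_F fi.
apply: (le_integrable measurableT _ _ iF).
  apply/measurable_EFinP; apply: (measurableT_comp (@fine_measurable R setT measurableT)).
  exact: (measurable_int _ iF).
move=> x _ /=; rewrite /Rintegral /fubini_F /=.
by case: (\int[m2]_y (f (x, y))%:E)%E => [y| |]//=; rewrite leey.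
Qed.

Lemma integrable_tensor (g : T1 -> R) (h : T2 -> R) :
  m1.-integrable setT (EFin \o g) -> m2.-integrable setT (EFin \o h) ->
  (m1 \x m2)%E.-integrable setT (EFin \o (fun z => g z.1 * h z.2)).
Proof.
move=> ig ih.
have mg : measurable_fun setT g by apply/measurable_EFinP; exact: measurable_int ig.
have mh : measurable_fun setT h by apply/measurable_EFinP; exact: measurable_int ih.
apply/integrable12ltyP.
  apply/measurable_EFinP; apply: measurable_funM.
    exact: (measurableT_comp mg measurable_fst).
  exact: (measurableT_comp mh measurable_snd).
have iah : m2.-integrable setT (EFin \o (fun y => `|h y|)).
  exact: (integrable_norm ih).
have iag : m1.-integrable setT (EFin \o (fun y => `|g y|)).
  exact: (integrable_norm ig).
under eq_integral => x _.
  under eq_integral => y _ do rewrite /= normrM EFinM.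
  rewrite integralZl//.
  rewrite -(fineK (integrable_fin_num measurableT iah)).
  over.
rewrite integralZr// -(fineK (integrable_fin_num measurableT iag)) -EFinM.
exact: ltry.
Qed.

End real_fubini.

(** * Affine changes of variables *)

Section change_of_variables.
Context {R : realType}.
Local Open Scope ereal_scope.

Lemma measurable_affine (c b : R) :
  measurable_fun [set: measurableTypeR R]
    (fun s : measurableTypeR R => (b - c * s)%R : measurableTypeR R).
Proof.
by apply: measurable_funB => //; apply: measurable_funM.
Qed.

(** Both sides are measures in [A] that agree on half-open intervals. *)
Lemma lebesgue_measure_affine (c b : R) : (0 < c)%R ->
  forall A : set (measurableTypeR R), measurable A ->
  lebesgue_measure A = c%:E * lebesgue_measure ((fun s : R => b - c * s)%R @^-1` A).
Proof.
move=> c0 A mA.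
pose P := measure_function_pushforward__canonical__measure_function_Measure
    (@lebesgue_measure R) (measurable_affine c b).
pose k : {nonneg R} := NngNum (ltW c0).
transitivity (mscale k P A); last by [].
apply: lebesgue_measure_unique => // _ [[x y] _ <-] /=.
rewrite /mscale /= /pushforward.
have -> : (fun s : R => b - c * s)%R @^-1` `]x, y] = `[((b - y) / c)%R, ((b - x) / c)%R[%classic.
  apply/seteqP; split => s /=; rewrite !in_itv/= ler_pdivrMr// ltr_pdivlMr//.
    by move=> /andP[? ?]; apply/andP; split; lra.
  by move=> /andP[? ?]; apply/andP; split; lra.
rewrite !lebesgue_measure_itv/= !lte_fin ltr_pM2r ?invr_gt0//.
have -> : (b - y < b - x)%R = (x < y)%R by rewrite ltrD2l ltrN2.
case: ifP => xy; last by rewrite mule0.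
by rewrite -!EFinD -EFinM; congr (_%:E); field; rewrite gt_eqF.
Qed.

Lemma ge0_integral_affine (c b : R) (f : R -> \bar R) : (0 < c)%R ->
  measurable_fun setT f -> (forall s, 0 <= f s) ->
  \int[lebesgue_measure]_s f s =
  c%:E * \int[lebesgue_measure]_s f (b - c * s)%R.
Proof.
move=> c0 mf f0.
have mphi := measurable_affine c b.
pose P := measure_function_pushforward__canonical__measure_function_Measure
    (@lebesgue_measure R) mphi.
pose k : {nonneg R} := NngNum (ltW c0).
have := @ge0_integral_pushforward _ _ _ _ R _ mphi lebesgue_measure setT f.
move=> /(_ measurableT mf (fun y _ => f0 y)); rewrite preimage_setT => <-.
rewrite -[c%:E]/(k%:num%:E) -(@ge0_integral_mscale _ _ _ P _ _ k f)//.
apply: eq_measure_integral => A mA _.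
by rewrite /= (lebesgue_measure_affine b c0 mA).
Qed.

Lemma ge0_integral_rVS n (f : 'rV[R]_n.+1 -> \bar R) :
  measurable_fun setT f -> (forall x, 0 <= f x) ->
  \int[lebesgue_rV n.+1]_x f x =
  \int[lebesgue_measure]_a \int[lebesgue_rV n]_y f (cons_rV (a, y)).
Proof.
move=> mf f0.
have mc := @measurable_cons_rV R n.
rewrite /= /lebesgue_cons.
have := @ge0_integral_pushforward _ _ _ _ R _ mc
  (@lebesgue_measure R \x lebesgue_rV n) setT f.
move=> /(_ measurableT mf (fun y _ => f0 y)).
rewrite preimage_setT => ->.
rewrite fubini_tonelli1//; first exact: (measurableT_comp mf mc).
by move=> z; exact: f0.
Qed.

Lemma measurable_rV_affine n (c : R) (x : 'rV[R]_n) :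
  measurable_fun setT (fun y : 'rV[R]_n => (x - c *: y)%R).
Proof.
apply/measurable_fun_rVP => i.
rewrite [X in measurable_fun _ X](_ : _ =
    (fun s => (x ord0 i - c * s)%R) \o rV_coord i).
  exact: (measurableT_comp (measurable_affine c _) (measurable_rV_coord i)).
by apply/funext => y; rewrite /rV_coord /= !mxE.
Qed.

Lemma ge0_integral_rV_affine n (c : R) (x : 'rV[R]_n) (f : 'rV[R]_n -> \bar R) :
  (0 < c)%R -> measurable_fun setT f -> (forall y, 0 <= f y) ->
  \int[lebesgue_rV n]_y f y =
  (c ^+ n)%:E * \int[lebesgue_rV n]_y f (x - c *: y)%R.
Proof.
move=> c0; elim: n x f => [|n IHn] x f mf f0.
  rewrite expr0 mul1e; apply: eq_integral => y _.
  by congr f; apply/rowP; case.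
have mfc : measurable_fun setT (f \o @cons_rV R n).
  exact: (measurableT_comp mf (@measurable_cons_rV R n)).
have mc := measurable_affine c (x ord0 ord0).
pose x' : 'rV[R]_n := \row_i x ord0 (lift ord0 i).
have consE a y : (x - c *: cons_rV (a, y))%R =
    cons_rV ((x ord0 ord0 - c * a)%R, (x' - c *: y)%R).
  apply/rowP => i; rewrite !mxE; case: unliftP => [j ->|->] //=.
  by rewrite !mxE.
rewrite ge0_integral_rVS// ge0_integral_rVS; last 2 first.
- exact: (measurableT_comp mf (@measurable_rV_affine n.+1 c x)).
- by move=> y; exact: f0.
rewrite (ge0_integral_affine (x ord0 ord0) c0); last 2 first.
- exact: (@measurable_fun_fubini_tonelli_F _ _ _ _ _ (lebesgue_rV n) _ mfc
    (fun z => f0 _)).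
- by move=> a; exact: integral_ge0.
rewrite exprS EFinM -muleA; congr (_ * _).
rewrite -ge0_integralZl//; last 3 first.
- under eq_fun do under eq_integral do rewrite consE.
  apply: (@measurable_fun_fubini_tonelli_F _ _ _ _ _ (lebesgue_rV n)
    (fun z => f (cons_rV ((x ord0 ord0 - c * z.1)%R, (x' - c *: z.2)%R))) _
    (fun z => f0 _)).
  apply: (measurableT_comp mfc); apply/measurable_fun_pairP; split.
    exact: (measurableT_comp mc measurable_fst).
  exact: (measurableT_comp (@measurable_rV_affine n c x') measurable_snd).
- by move=> a _; exact: integral_ge0.
- by rewrite lee_fin exprn_ge0// ltW.
apply: eq_integral => a _.
under [in RHS]eq_integral do rewrite consE.
apply: IHn => //.
exact: (measurableT_comp mfc (pair1_measurable _)).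
Qed.

End change_of_variables.

Section parabolic.
Context {R : realType} {n : nat}.
Local Notation spacetime := ('rV[R]_n * measurableTypeR R)%type.
Local Notation mu := (@spacetime_measure R n).
Local Open Scope ereal_scope.

(** The points averaged at [z] by a kernel rescaled to size [r]: [w] runs over
    the unscaled kernel, space being dilated by [r] and time by [r ^ 2]. *)
Definition backshift (r : R) (z w : spacetime) : spacetime :=
  ((z.1 - r *: w.1)%R, (z.2 - r ^+ 2 * w.2)%R).

Lemma measurable_backshift r z : measurable_fun setT (backshift r z).
Proof.
apply/measurable_fun_pairP; split.
  exact: (measurableT_comp (@measurable_rV_affine R n r z.1) measurable_fst).
exact: (measurableT_comp (@measurable_affine R (r ^+ 2) z.2) measurable_snd).
Qed.

Lemma ge0_integral_backshift r z (f : spacetime -> \bar R) : (0 < r)%R ->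
  measurable_fun setT f -> (forall w, 0 <= f w) ->
  \int[mu]_w f w = (r ^+ (n + 2))%:E * \int[mu]_w f (backshift r z w).
Proof.
move=> r0 mf f0; have r20 : (0 < r ^+ 2)%R by exact: exprn_gt0.
have mz := measurable_backshift r z.
have mfz := measurableT_comp mf mz.
rewrite /spacetime_measure (fubini_tonelli1 _ mf)//.
rewrite (fubini_tonelli1 _ mfz) => [|w]; last exact: f0.
rewrite (ge0_integral_rV_affine z.1 r0); last 2 first.
- exact: measurable_fun_fubini_tonelli_F.
- by move=> a; exact: integral_ge0.
rewrite exprD EFinM -muleA; congr (_ * _).
rewrite -ge0_integralZl//; last 3 first.
- apply: (@measurable_fun_fubini_tonelli_F _ _ _ _ _ (@lebesgue_measure R)
    (fun z' => f (backshift r z z')) _ (fun z => f0 _)).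
  exact: (measurableT_comp mf mz).
- by move=> a _; apply: integral_ge0 => s _; exact: f0.
- by rewrite lee_fin ltW.
apply: eq_integral => y _.
rewrite /fubini_F -(ge0_integral_affine z.2 r20 (f := fun s => f ((z.1 - r *: y)%R, s)))//.
exact: measurableT_comp.
Qed.

(** The factor stays inside the integral so that positive and negative parts
    can be transformed separately, whether or not [f] is integrable. *)
Lemma integral_backshift r z (f : spacetime -> \bar R) : (0 < r)%R ->
  measurable_fun setT f ->
  \int[mu]_w f w = \int[mu]_w ((r ^+ (n + 2))%:E * f (backshift r z w)).
Proof.
move=> r0 mf; have rn0 : (0 <= r ^+ (n + 2))%R by rewrite exprn_ge0// ltW.
have mz := measurable_backshift r z.
have ge0 (g : spacetime -> \bar R) : measurable_fun setT g ->
    (forall w, 0 <= g w) ->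
  \int[mu]_w g w = \int[mu]_w ((r ^+ (n + 2))%:E * g (backshift r z w)).
  move=> mg g0; rewrite ge0_integralZl//.
  - exact: ge0_integral_backshift.
  - exact: (measurableT_comp mg mz).
rewrite integralE (ge0 f^\+)//; last exact: measurable_funepos.
rewrite (ge0 f^\-)//; last exact: measurable_funeneg.
rewrite [RHS]integralE; congr (_ - _); apply: eq_integral => w _.
  by rewrite (ge0_funeposM (fun w => f (backshift r z w)) rn0) !funeposE.
by rewrite (ge0_funenegM (fun w => f (backshift r z w)) rn0) !funenegE.
Qed.

Lemma negligible_backshift r z (N : set spacetime) : (0 < r)%R ->
  measurable N -> mu N = 0 -> mu (backshift r z @^-1` N) = 0.
Proof.
move=> r0 mN N0.
have mzN : measurable (backshift r z @^-1` N).
  by rewrite -[X in measurable X]setTI; exact: measurable_backshift.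
have := @ge0_integral_backshift r z (EFin \o \1_N) r0.
rewrite integral_indic// setIT N0.
rewrite (_ : (fun w => _ (backshift r z w)) = EFin \o \1_(backshift r z @^-1` N))//.
rewrite integral_indic// setIT => /(_ _ _)/esym/eqP.
rewrite mule_eq0 eqe gt_eqF ?exprn_gt0//= => H; apply/eqP/H => //.
by apply/measurable_EFinP.
Qed.

(** In the new variable the scale acts on [v] alone, and all averages are taken
    against the same kernel.  Passing from [H] to [G] uses that the
    substitution preserves null sets. *)
Lemma spacetime_conv_scale r (H G v : spacetime -> R) z : (0 < r)%R ->
  measurable_fun setT G -> measurable_fun setT v ->
  {ae mu, forall w, H w = G w} ->
  spacetime_conv (parabolic_scale r H) v z =
  (\int[mu]_w (G w * v (backshift r z w)))%R.
Proof.
move=> r0 mG mv [N [mN N0 HG]].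
have rn0 : (r ^+ (n + 2) != 0)%R by rewrite expf_neq0// gt_eqF.
rewrite /spacetime_conv /Rintegral; congr fine.
(* The map z' |-> (z - z') rescaled by 1/r is again a backshift. *)
pose S := backshift r^-1 (r^-1 *: z.1, (r^-1) ^+ 2 * z.2)%R.
have SE w : S w = (r^-1 *: (z - w).1, (z - w).2 / r ^+ 2)%R.
  by rewrite /S /backshift/= scalerBr; congr pair; rewrite exprVn; ring.
transitivity (\int[mu]_w ((r ^+ (n + 2))^-1 * G (S w) * v w)%:E).
  apply: integral_eq_ae; exists (S @^-1` N); split.
  - by rewrite -[X in measurable X]setTI; exact: measurable_backshift.
  - by apply: negligible_backshift => //; rewrite invr_gt0.
  move=> w /=; rewrite /parabolic_scale -SE => h; apply: HG => /= HGw.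
  by apply: h; rewrite HGw.
have mS : measurable_fun setT S by exact: measurable_backshift.
rewrite (integral_backshift z r0); last first.
  apply/measurable_EFinP; apply: measurable_funM => //.
  by apply: measurable_funM => //; exact: (measurableT_comp mG mS).
apply: eq_integral => w _; rewrite -EFinM; congr EFin.
have -> : S (backshift r z w) = w.
  rewrite SE /backshift; case: w => y s; congr pair => /=.
    by rewrite subKr scalerA mulVf ?gt_eqF// scale1r.
  by rewrite subKr mulrAC divff ?mul1r// expf_neq0// gt_eqF.
by rewrite !mulrA divff// mul1r.
Qed.

End parabolic.

(** * Borel measurability *)

Section quantization.
Context {R : realType} {n : nat}.
Local Notation spacetime := ('rV[R]_n * measurableTypeR R)%type.

(** Rounding down to the grid of mesh [1 / (k + 1)] is split into an integer
    code and its decoding, since the codes form a countable type. *)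
Definition grid_code (k : nat) (z : spacetime) : {ffun 'I_n -> int} * int :=
  ([ffun i => Num.floor (k.+1%:R * z.1 ord0 i)], Num.floor (k.+1%:R * z.2)).

Definition grid_point (k : nat) (c : {ffun 'I_n -> int} * int) : spacetime :=
  (\row_i ((c.1 i)%:~R / k.+1%:R), c.2%:~R / k.+1%:R).

Definition quantize k z := grid_point k (grid_code k z).

Let cell k (m : int) : set (measurableTypeR R) :=
  [set s : R | Num.floor (k.+1%:R * s) = m].

Let measurable_cell k m : measurable (cell k m).
Proof.
rewrite (_ : cell k m = `[m%:~R / k.+1%:R, (m + 1)%:~R / k.+1%:R[%classic).
  exact: measurable_itv.
apply/seteqP; split => s /=; rewrite in_itv/= ler_pdivrMr// ltr_pdivlMr//;
  rewrite ![(s * _)%R]mulrC.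
  by move=> <-; rewrite floor_le_tmp floorD1_gt.
by move=> h; apply/eqP; rewrite floor_eq.
Qed.

(** The composite takes countably many values, each on a union of grid
    cells. *)
Lemma measurable_comp_quantize (g : spacetime -> R) k :
  measurable_fun setT (g \o quantize k).
Proof.
move=> _ Y mY; rewrite setTI.
rewrite (_ : _ @^-1` _ = \bigcup_(c in [set c | Y (g (grid_point k c))])
    ([set x : 'rV[R]_n | forall i, cell k (c.1 i) (x ord0 i)] `*` cell k c.2)).
  rewrite bigcup_mkcond; apply: countable_bigcupT_measurable => // c.
  case: ifP => _ //; apply: measurableX => //.
  by apply: (measurable_rV_box (A := fun i => cell k (c.1 i))).
apply/seteqP; split => [z Yz|z [c /= Yc [cz1 cz2]]] /=.
  exists (grid_code k z) => //=; split => //= i.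
  by rewrite /cell/= ffunE.
rewrite /quantize (_ : grid_code k z = c)//.
case: c cz1 cz2 {Yc} => [c1 c2] /= cz1 cz2; congr pair => //.
by apply/ffunP => i; rewrite ffunE; exact: cz1.
Qed.

(** Rounding down cannot make a nonnegative time negative; this lets functions
    that are continuous on the half-space only be approximated from within. *)
Lemma quantize_halfspace k z : halfspace z -> halfspace (quantize k z).
Proof.
rewrite /halfspace /= => z0; rewrite divr_ge0//.
by rewrite ler0z floor_ge0 mulr_ge0.
Qed.

Lemma cvg_quantize z : quantize k z @[k --> \oo] --> z.
Proof.
have near_floor (s : R) k : `|s - (Num.floor (k.+1%:R * s))%:~R / k.+1%:R| <= k.+1%:R^-1.
  rewrite -[X in X - _](mulKf (_ : k.+1%:R != 0 :> R))// mulrC -mulrBl normrM.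
  rewrite [X in _ * X]gtr0_norm ?invr_gt0// ler_piMl ?invr_ge0//.
  rewrite ger0_norm ?subr_ge0 ?floor_le_tmp// lerBlDl.
  by have /ltW := floorD1_gt (k.+1%:R * s); rewrite intrD.
apply/cvg_ballP => e e0.
near=> k.
have ke : (k.+1%:R^-1 < e :> R).
  near: k; exact: (near_infty_natSinv_lt (PosNum e0)).
split; last first.
  by rewrite /ball/=; apply: le_lt_trans ke; exact: near_floor.
split => // i j; rewrite /ball/= (ord1 i) !mxE.
rewrite ffunE.
by apply: le_lt_trans ke; exact: near_floor.
Unshelve. all: by end_near. Qed.

Lemma measurable_halfspace : measurable (halfspace : set spacetime).
Proof.
rewrite (_ : halfspace = snd @^-1` (`[0%R, +oo[%classic : set (measurableTypeR R))).
  by rewrite -[X in measurable X]setTI; exact: measurable_snd.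
by apply/seteqP; split => z; rewrite /halfspace/= in_itv/= andbT.
Qed.

Lemma measurable_within_halfspace (u : spacetime -> R) :
  {within halfspace, continuous u} -> measurable_fun halfspace u.
Proof.
move=> /subspace_continuousP cu.
apply: (@measurable_fun_cvg _ _ _ _ (fun k => u \o quantize k)).
  by move=> k; apply: measurable_funTS; exact: measurable_comp_quantize.
move=> z hz; apply: (cvg_comp _ _ _ (cu z hz)) => A /= wA.
have : \forall k \near \oo, halfspace (quantize k z) -> A (quantize k z).
  exact: (@cvg_quantize z _ wA).
by apply: filterS => k /=; apply; exact: quantize_halfspace.
Qed.

End quantization.

Lemma measurable_continuous_rV {R : realType} n (f : 'rV[R]_n -> R) :
  continuous f -> measurable_fun setT f.
Proof.
move=> cf.
have mf := @measurable_within_halfspace R n (f \o fst).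
have : measurable_fun halfspace (f \o @fst 'rV[R]_n (measurableTypeR R)).
  apply: mf; apply: continuous_subspaceT => z.
  apply: (@cvg_comp _ _ _ fst f); last exact: cf.
  exact: cvg_fst.
move=> {}mf.
rewrite (_ : f = (f \o fst) \o (fun x => (x, 0 : measurableTypeR R)))//.
apply: (measurable_comp _ _ mf) => //.
- exact: measurable_halfspace.
- by move=> _ /= [x _ <-]; rewrite /halfspace/=.
Qed.

Lemma measurable_rV_sub (R : realType) d (T : measurableType d) n (f g : T -> 'rV[R]_n) :
  measurable_fun setT f -> measurable_fun setT g ->
  measurable_fun setT (fun w => f w - g w).
Proof.
move=> /measurable_fun_rVP mf /measurable_fun_rVP mg; apply/measurable_fun_rVP => i.
rewrite (_ : _ \o _ = (fun w => (rV_coord i \o f) w - (rV_coord i \o g) w)).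
  exact: measurable_funB (mf i) (mg i).
by apply/funext => w; rewrite /rV_coord /= !mxE.
Qed.

(** * The Euclidean inner product *)

Section dot_product.
Context {R : realType}.

Definition dotr n (x y : 'rV[R]_n) : R := \sum_i x ord0 i * y ord0 i.

Lemma enorm_sqr n (x : 'rV[R]_n) : enorm x ^+ 2 = dotr x x.
Proof.
by rewrite /enorm sqr_sqrtr ?sumr_ge0// => i _; rewrite sqr_ge0.
Qed.

Lemma dotr_ge0 n (x : 'rV[R]_n) : 0 <= dotr x x.
Proof. by rewrite -enorm_sqr sqr_ge0. Qed.

Lemma dotr_consl n (a : R) (y : 'rV[R]_n) (x : 'rV[R]_n.+1) :
  dotr x (cons_rV (a, y)) =
  x ord0 ord0 * a + dotr (\row_i x ord0 (lift ord0 i)) y.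
Proof.
rewrite /dotr big_ord_recl mxE unlift_none; congr (_ + _).
by apply: eq_bigr => i _; rewrite !mxE liftK.
Qed.

Lemma dotr_cons n (a : R) (y : 'rV[R]_n) :
  dotr (cons_rV (a, y)) (cons_rV (a, y)) = a ^+ 2 + dotr y y.
Proof.
rewrite dotr_consl mxE unlift_none; congr (_ + dotr _ _).
by apply/rowP => i; rewrite !mxE liftK.
Qed.

Lemma dotr_recl n (x : 'rV[R]_n.+1) :
  dotr x x = x ord0 ord0 ^+ 2 +
    dotr (\row_i x ord0 (lift ord0 i)) (\row_i x ord0 (lift ord0 i)).
Proof.
by rewrite /dotr big_ord_recl expr2; congr (_ + _); apply: eq_bigr => i _; rewrite !mxE.
Qed.

Lemma dotrC n (x y : 'rV[R]_n) : dotr x y = dotr y x.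
Proof. by apply: eq_bigr => i _; rewrite mulrC. Qed.

Lemma dotrBl n (x y z : 'rV[R]_n) : dotr (x - y) z = dotr x z - dotr y z.
Proof. by rewrite /dotr -sumrB; apply: eq_bigr => i _; rewrite !mxE mulrBl. Qed.

Lemma dotrZl n c (x z : 'rV[R]_n) : dotr (c *: x) z = c * dotr x z.
Proof. by rewrite /dotr mulr_sumr; apply: eq_bigr => i _; rewrite !mxE mulrA. Qed.

Lemma dotrZr n c (x z : 'rV[R]_n) : dotr x (c *: z) = c * dotr x z.
Proof. by rewrite dotrC dotrZl dotrC. Qed.

Lemma dotr0l n (z : 'rV[R]_n) : dotr 0 z = 0.
Proof. by rewrite /dotr big1// => i _; rewrite mxE mul0r. Qed.

Lemma measurable_fun_dotr d (T : measurableType d) n (f g : T -> 'rV[R]_n) :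
  measurable_fun setT f -> measurable_fun setT g ->
  measurable_fun setT (fun w => dotr (f w) (g w)).
Proof.
move=> /measurable_fun_rVP mf /measurable_fun_rVP mg.
apply: measurable_sum => i; apply: measurable_funM; [exact: mf|exact: mg].
Qed.

Lemma dotrDr n (x y z : 'rV[R]_n) : dotr x (y + z) = dotr x y + dotr x z.
Proof. by rewrite /dotr -big_split/=; apply: eq_bigr => i _; rewrite !mxE mulrDr. Qed.

Lemma dotrNr n (x y : 'rV[R]_n) : dotr x (- y) = - dotr x y.
Proof. by rewrite /dotr -sumrN; apply: eq_bigr => i _; rewrite mxE mulrN. Qed.

Lemma continuous_dotr n (x : 'rV[R]_n) : continuous (dotr x).
Proof.
rewrite /dotr; elim: (index_enum _) => [|i s IHs].
  have -> : (fun y : 'rV[R]_n => \sum_(j <- [::]) x ord0 j * y ord0 j) = cst 0.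
    by apply/funext => y; rewrite big_nil.
  by move=> y; apply: cst_continuous.
have -> : (fun y : 'rV[R]_n => \sum_(j <- i :: s) x ord0 j * y ord0 j) =
    (fun y => x ord0 i * y ord0 i + \sum_(j <- s) x ord0 j * y ord0 j).
  by apply/funext => y; rewrite big_cons.
move=> y; have FF : Filter (nbhs (y : 'rV[R]_n)) by exact: nbhs_filter.
apply: (@cvgD _ _ _ _ FF); last exact: IHs.
by apply: (@cvgM _ _ _ FF); [exact: cvg_cst|exact: coord_continuous].
Qed.

End dot_product.

(** * Truncation of power series at parabolic degree N *)

Section truncation.
Context {R : realType}.
Implicit Types (a b r : R) (s rho : nat -> R).

(** The terms of parabolic degree less than [N]: [j] indexes powers of a
    quantity that scales like [r ^ 2] and counts twice. *)
Definition parabolic_sum N (F : nat -> nat -> R) : R :=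
  \sum_(0 <= m < N) \sum_(0 <= j < N | (m + j.*2 < N)%N) F m j.

Lemma parabolic_sum_widen N M F : (N <= M)%N ->
  parabolic_sum N F =
  \sum_(0 <= m < M) \sum_(0 <= j < M | (m + j.*2 < N)%N) F m j.
Proof.
move=> NM; rewrite /parabolic_sum.
transitivity (\sum_(0 <= m < N) \sum_(0 <= j < M | (m + j.*2 < N)%N) F m j).
  apply: eq_bigr => m _; rewrite (big_nat_widen _ _ _ _ _ NM).
  by apply: eq_bigl => j /=; lia.
rewrite (big_nat_widen _ _ _ _ _ NM) big_mkcond/=; apply: eq_bigr => m _.
by case: ltnP => // Nm; rewrite big_pred0// => j; lia.
Qed.

(** The Taylor series of [S] at 0 is dominated by that of [expR]. *)
Definition majorized_series s (S : R -> R) :=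
  (forall m, `|s m| <= 1) /\
  forall a, series (fun m => s m * exp_coeff a m) @ \oo --> S a.

Lemma series_exp_coeff_le a N : 0 <= a -> \sum_(0 <= m < N) exp_coeff a m <= expR a.
Proof.
move=> a0; apply: nondecreasing_cvgn_le; last exact: is_cvg_series_exp_coeff.
by apply: nondecreasing_series => m _ _; exact: exp_coeff_ge0.
Qed.

(** A missing term has [N <= m + 2 j], hence
    [r ^ (m + 2 j) <= (r / 2) ^ N * 2 ^ m * 4 ^ j]; the powers of 2 and 4 turn
    the sum of all such terms into exponential series at [2 |a|] and
    [4 |b|]. *)
Lemma parabolic_truncation s rho S B a b r N :
  majorized_series s S -> majorized_series rho B -> 0 <= r <= 1 ->
  `|S (r * a) * B (r ^+ 2 * b) -
    parabolic_sum N (fun m j => s m * rho j * (exp_coeff a m * exp_coeff b j)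
                                * r ^+ (m + j.*2))|
  <= (r / 2) ^+ N * expR (2 * `|a| + 4 * `|b|).
Proof.
move=> [s1 cS] [rho1 cB] /andP[r0 r1].
set P := parabolic_sum _ _.
pose u M := series (fun m => s m * exp_coeff (r * a) m) M *
    series (fun j => rho j * exp_coeff (r ^+ 2 * b) j) M - P.
have cSB : u @ \oo --> S (r * a) * B (r ^+ 2 * b) - P.
  by apply: cvgB; [apply: cvgM; [exact: cS|exact: cB]|exact: cvg_cst].
have /cvgrPdist_le cvgN : `|u M| @[M --> \oo] --> `|S (r * a) * B (r ^+ 2 * b) - P|.
  exact: cvg_norm.
apply/ler_addgt0Pl => e e0.
(* Replace the two series by partial sums with M >= N terms, up to e. *)
have [M NM] : exists2 M, (N <= M)%N & `| `|S (r * a) * B (r ^+ 2 * b) - P| - `|u M| | <= e.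
  have := cvgN _ e0 => -[M0 _ HM0].
  by exists (maxn N M0); [exact: leq_maxl|apply: HM0; exact: leq_maxr].
move=> /(le_trans (ler_norm _)); rewrite lerBlDr => /le_trans; apply.
rewrite /u lerD2l /P (parabolic_sum_widen _ NM).
rewrite /series/= big_distrlr/= -sumrB.
under eq_bigr => m _.
  rewrite (bigID (fun j => (m + j.*2 < N)%N))/=.
  rewrite [X in X + _ - _](eq_bigr (fun j => s m * rho j * (exp_coeff a m * exp_coeff b j)
                                * r ^+ (m + j.*2))); last first.
    move=> j _; rewrite /exp_coeff/= exprD -mul2n exprM expr2 !exprMn; ring.
  rewrite addrAC subrr add0r.
  over.
apply: (le_trans (ler_norm_sum _ _ _)).
rewrite expRD.
apply: (@le_trans _ _ (\sum_(0 <= m < M) \sum_(0 <= j < M)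
   (r / 2) ^+ N * (exp_coeff (2 * `|a|) m * exp_coeff (4 * `|b|) j))).
  apply: ler_sum => m _; apply: (le_trans (ler_norm_sum _ _ _)).
  rewrite [leRHS](bigID (fun j => (m + j.*2 < N)%N))/= ler_wpDl//.
    apply: sumr_ge0 => j _; rewrite mulr_ge0 ?exprn_ge0 ?divr_ge0//.
    by rewrite mulr_ge0// exp_coeff_ge0// mulr_ge0.
  apply: ler_sum => j; rewrite -leqNgt => Nmj.
  apply: (@le_trans _ _ ((r / 2) ^+ (m + j.*2) *
      (exp_coeff (2 * `|a|) m * exp_coeff (4 * `|b|) j))).
    rewrite normrM [X in X * _]normrM [X in _ * X]normrM.
    apply: (@le_trans _ _ (`|exp_coeff (r * a) m| * `|exp_coeff (r ^+ 2 * b) j|)).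
      by rewrite ler_pM ?mulr_ge0 ?ler_piMl.
    rewrite le_eqVlt; apply/orP; left; apply/eqP.
    rewrite /exp_coeff/= !normrM !normfV !normr_nat !normrX !normrM.
    rewrite !(ger0_norm r0).
    have -> : (4 : R) = 2 * 2 by ring.
    rewrite exprD -mul2n exprM !expr2 !exprMn !exprVn.
    have e22 k : (2 : R) ^+ k != 0 by rewrite expf_neq0.
    have f0 k : (k`!%:R : R) != 0 by rewrite pnatr_eq0 -lt0n fact_gt0.
    by field; rewrite !f0 !e22.
  rewrite ler_wpM2r//; last first.
    by rewrite ler_wiXn2l ?divr_ge0// ler_pdivrMr// mul1r (le_trans r1)// ler1n.
  by rewrite mulr_ge0// exp_coeff_ge0// mulr_ge0.
under eq_bigr do rewrite -mulr_sumr.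
rewrite -mulr_sumr -big_distrlr/= ler_wpM2l ?exprn_ge0 ?divr_ge0//.
by rewrite ler_pM ?series_exp_coeff_le ?mulr_ge0// sumr_ge0// => m _;
  rewrite exp_coeff_ge0// mulr_ge0.
Qed.

Lemma majorized_expR : majorized_series (fun=> 1) expR.
Proof.
split=> [_|a]; first by rewrite normr1.
under eq_fun do rewrite mul1r.
exact: is_cvg_series_exp_coeff.
Qed.

Lemma majorized_expRN : majorized_series (fun j => (-1) ^+ j) (fun b => expR (- b)).
Proof.
split=> [j|b]; first by rewrite normrX normrN normr1 expr1n.
rewrite (_ : (fun j => _) = exp_coeff (- b)).
  exact: is_cvg_series_exp_coeff.
by apply/funext => j; rewrite /exp_coeff/= [in RHS]exprNn mulrA.
Qed.

Lemma majorized_cos : majorized_series (fun m => (~~ odd m)%:R * (-1) ^+ m./2) cos.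
Proof.
split=> [m|a].
  by rewrite normrM normrX normrN normr1 expr1n mulr1; case: odd; rewrite ?normr0 ?normr1.
rewrite (_ : (fun m => _) = cos_coeff a).
  by rewrite cos.unlock; exact: is_cvg_series_cos_coeff.
by apply/funext => j; rewrite /exp_coeff /cos_coeff/= !mulrA.
Qed.

Lemma majorized_sin : majorized_series (fun m => (odd m)%:R * (-1) ^+ m.-1./2) sin.
Proof.
split=> [m|a].
  by rewrite normrM normrX normrN normr1 expr1n mulr1; case: odd; rewrite ?normr0 ?normr1.
rewrite (_ : (fun m => _) = sin_coeff a).
  by rewrite sin.unlock; exact: is_cvg_series_sin_coeff.
by apply/funext => j; rewrite /exp_coeff /sin_coeff/= !mulrA.
Qed.

(** Such a polynomial vanishes at 0; dividing by ['X] lowers [N] by one. *)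
Lemma poly_bigO_eq0 (N : nat) (p : {poly R}) (K d : R) : 0 < d ->
  (size p <= N)%N -> (forall r, 0 < r < d -> `|p.[r]| <= K * r ^+ N) -> p = 0.
Proof.
move=> d0; elim: N p => [|N IHN] p; first by rewrite leqn0 size_poly_eq0 => /eqP.
move=> sp hp.
have p0 : root p 0.
  rewrite /root -normr_le0.
  have c1 : `|p.[r]| @[r --> 0^'+] --> `|p.[0]|.
    by apply: cvg_norm; apply: cvg_at_right_filter; exact: continuous_horner.
  have c2 : K * r ^+ N.+1 @[r --> 0^'+] --> K * 0 ^+ N.+1.
    by apply: cvgM; [exact: cvg_cst|apply: cvg_at_right_filter; exact: exprn_continuous].
  rewrite expr0n mulr0 in c2.
  apply: (ler_cvg_to c1 c2); near=> r; apply: hp; apply/andP; split.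
    by near: r; exact: nbhs_right_gt.
  by near: r; exact: nbhs_right_lt.
have [q pq] := factor_theorem p 0 p0.
rewrite subr0 in pq.
rewrite pq (IHN q) ?mul0r//.
  have [->|q0] := eqVneq q 0; first by rewrite size_poly0.
  by move: sp; rewrite pq size_mulX.
move=> r /andP[r0 rd].
have := hp r; rewrite r0 rd => /(_ isT).
rewrite pq hornerM hornerX normrM (gtr0_norm r0) exprSr mulrA.
by rewrite ler_pM2r.
Unshelve. all: by end_near. Qed.
End truncation.

(** * From real to imaginary exponentials *)

(** Throughout, [a] is a quantity of degree 1 and [b] one of degree 2 for the
    scale [r]; in the applications [expR (r * a + r ^+ 2 * b)] is an exponential
    temperature evaluated at a dilated point. *)
Section continuation.
Context d (T : measurableType d) {R : realType} (mu : {measure set T -> \bar R}).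
Variables G a b : T -> R.
Hypotheses (mG : measurable_fun setT G) (ma : measurable_fun setT a)
  (mb : measurable_fun setT b).
Let E w := expR (2 * `|a w| + 4 * `|b w|).
Hypothesis iE : mu.-integrable setT (EFin \o (fun w => G w * E w)).

Let K := \int[mu]_w `|G w * E w|.
Let mom m j := \int[mu]_w (G w * (exp_coeff (a w) m * exp_coeff (b w) j)).

Let iE' : mu.-integrable setT (EFin \o (fun w => `|G w * E w|)).
Proof. exact: (integrable_norm iE). Qed.

Let measurable_exp_coeff m (f : T -> R) : measurable_fun setT f ->
  measurable_fun setT (fun w => exp_coeff (f w) m).
Proof. by move=> mf; apply: measurable_funM => //; exact: measurable_funX. Qed.

Let i_mom m j : mu.-integrable setT
  (EFin \o (fun w => G w * (exp_coeff (a w) m * exp_coeff (b w) j))).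
Proof.
apply: dominated_integrable iE' _.
  by apply: measurable_funM => //; apply: measurable_funM; exact: measurable_exp_coeff.
have le (x y : R) k : `|x| <= y -> `|exp_coeff x k| <= expR y.
  move=> xy; apply: (@le_trans _ _ (exp_coeff y k)).
    by rewrite /exp_coeff/= normrM normfV normr_nat normrX ler_wpM2r//
      lerXn2r ?nnegrE// (le_trans _ xy).
  have y0 : 0 <= y by exact: le_trans xy.
  apply: le_trans (series_exp_coeff_le k.+1 y0).
  by rewrite big_nat_recr//= lerDr sumr_ge0// => i _; exact: exp_coeff_ge0.
move=> w; rewrite [leRHS]normrM normrM ler_wpM2l// (ger0_norm (expR_ge0 _))//.
rewrite normrM /E expRD ler_pM// le// ler_peMl//; lra.
Qed.

(** Up to [O ((r / 2) ^ N)] the average is a polynomial in [r], with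
    coefficients given by the mixed moments of [a] and [b]. *)
Lemma moment_truncation s rho (S B : R -> R) r N :
  majorized_series s S -> majorized_series rho B ->
  measurable_fun setT S -> measurable_fun setT B -> 0 <= r <= 1 ->
  `|\int[mu]_w (G w * (S (r * a w) * B (r ^+ 2 * b w)))
    - parabolic_sum N (fun m j => s m * rho j * mom m j * r ^+ (m + j.*2))|
  <= (r / 2) ^+ N * K.
Proof.
move=> hS hB mS mB r01.
have mSB : measurable_fun setT (fun w => G w * (S (r * a w) * B (r ^+ 2 * b w))).
  apply: measurable_funM => //; apply: measurable_funM.
    by apply: (measurableT_comp mS); exact: measurable_funM.
  by apply: (measurableT_comp mB); exact: measurable_funM.
have iSB : mu.-integrable setT
    (EFin \o (fun w => G w * (S (r * a w) * B (r ^+ 2 * b w)))).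
  apply: dominated_integrable iE' _ => // w.
  rewrite !normrM -normrM ler_wpM2l// [leRHS]ger0_norm ?expR_ge0//.
  have := parabolic_truncation (a w) (b w) 0 hS hB r01.
  by rewrite /parabolic_sum big_geq// subr0 expr0 mul1r.
pose F m j w := s m * rho j * r ^+ (m + j.*2) *
   (G w * (exp_coeff (a w) m * exp_coeff (b w) j)).
have iF m j : mu.-integrable setT (EFin \o F m j) by exact: integrable_scaler.
have -> : parabolic_sum N (fun m j => s m * rho j * mom m j * r ^+ (m + j.*2)) =
    \int[mu]_w (parabolic_sum N (fun m j => F m j w)).
  rewrite Rintegral_sumr; last by move=> m _; exact: integrable_sumr.
  apply: eq_bigr => m _; rewrite Rintegral_sumr//; apply: eq_bigr => j _.
  by rewrite RintegralZl// mulrAC.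
have iP : mu.-integrable setT (EFin \o (fun w => parabolic_sum N (fun m j => F m j w))).
  by apply: integrable_sumr => m _; exact: integrable_sumr.
rewrite -RintegralB//.
have iSBP := integrable_subr iSB iP.
apply: (le_trans (le_normr_Rintegral measurableT iSBP)).
rewrite -RintegralZl//; apply: le_Rintegral => //.
- exact: (integrable_norm iSBP).
- exact: integrable_scaler.
move=> w _.
rewrite (_ : parabolic_sum N _ = G w *
  parabolic_sum N (fun m j => s m * rho j * (exp_coeff (a w) m * exp_coeff (b w) j)
                                * r ^+ (m + j.*2))); last first.
  rewrite /parabolic_sum mulr_sumr; apply: eq_bigr => m _.
  by rewrite mulr_sumr; apply: eq_bigr => j _; rewrite /F; ring.
rewrite -mulrBr normrM (normrM (G w) (E w)) mulrCA ler_wpM2l//.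
rewrite (ger0_norm (expR_ge0 _)).
exact: parabolic_truncation.
Qed.

(** The average of [expR (r * a + r ^+ 2 * b)] truncated below degree [N], as a
    polynomial in [r]. *)
Let momP N : {poly R} :=
  \sum_(0 <= m < N) \sum_(0 <= j < N | (m + j.*2 < N)%N) mom m j *: 'X^(m + j.*2).

Let functional_momP N (tau : nat -> R) :
  \sum_(k < N) (momP N)`_k * tau k =
  parabolic_sum N (fun m j => mom m j * tau (m + j.*2)%N).
Proof.
under eq_bigr do rewrite /momP coef_sum mulr_suml.
rewrite exchange_big/=; apply: eq_bigr => m _.
under eq_bigr do rewrite coef_sum mulr_suml.
rewrite exchange_big/=; apply: eq_bigr => j mjN.
rewrite (bigD1 (Ordinal mjN))//= coefZ coefXn eqxx mulr1 big1 ?addr0// => k.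
move=> kmj; rewrite coefZ coefXn (_ : (k == _ :> nat) = false) ?mulr0 ?mul0r//.
exact: negbTE kmj.
Qed.

(** Constancy for small [r] forces every [momP N] to be the constant [kappa].
    The condition on [s] says that replacing [exp a * exp b] by
    [S a * exp (- b)] multiplies all moments of the same parabolic degree [k]
    by the same number [s k], so that the truncations of the new average at
    [r = 1] are [kappa * s 0], with an error [O (2 ^ - N)]. *)
Lemma imaginary_continuation (kappa delta : R) (s : nat -> R) (S : R -> R) :
  0 < delta ->
  (forall r, 0 < r < delta ->
    \int[mu]_w (G w * expR (r * a w + r ^+ 2 * b w)) = kappa) ->
  majorized_series s S -> measurable_fun setT S ->
  (forall m j, s (m + j.*2)%N = (-1) ^+ j * s m) ->
  \int[mu]_w (G w * (S (a w) * expR (- b w))) = kappa * s 0%N.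
Proof.
move=> d0 hk hS mS sE.
have momE N : momP N.+1 = kappa%:P.
  apply/eqP; rewrite -subr_eq0; apply/eqP.
  (* Degree N at most, and O(r^(N+1)) at 0 by truncation. *)
  apply: (@poly_bigO_eq0 _ N.+1 _ (2 ^- N.+1 * K) (Num.min delta 1)).
  - by rewrite lt_min d0/=.
  - rewrite (leq_trans (size_polyD _ _))// geq_max size_polyN.
    rewrite (leq_trans (size_polyC_leq1 _))// andbT.
    rewrite (leq_trans (size_sum _ _ _))//; apply/bigmax_leqP_seq => m _ _.
    rewrite (leq_trans (size_sum _ _ _))//; apply/bigmax_leqP_seq => j _ mjN.
    by rewrite (leq_trans (size_scale_leq _ _))// size_polyXn.
  move=> r; rewrite lt_min => /and3P[r0 rd r1].
  have r01 : 0 <= r <= 1 by rewrite !ltW.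
  have := moment_truncation N.+1 majorized_expR majorized_expR
    (@measurable_expR R) (@measurable_expR R) r01.
  under eq_Rintegral do rewrite -expRD.
  rewrite hk ?r0// distrC (_ : _ * K = 2 ^- N.+1 * K * r ^+ N.+1); last first.
    by rewrite exprMn exprVn; ring.
  congr (`|_| <= _).
  rewrite hornerD hornerN hornerC; congr (_ - _).
  rewrite /momP horner_sum; apply: eq_bigr => m _.
  rewrite horner_sum; apply: eq_bigr => j _.
  by rewrite hornerZ hornerXn !mul1r.
apply/eqP; rewrite -subr_eq0 -normr_le0.
have bound N : `|\int[mu]_w (G w * (S (a w) * expR (- b w))) - kappa * s 0%N|
    <= (1 / 2) ^+ N.+1 * K.
  have r01 : (0 : R) <= 1 <= (1 : R) by rewrite lexx ler01.
  have mexpN : measurable_fun setT (fun x : R => expR (- x)).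
    by apply: measurableT_comp.
  have := moment_truncation N.+1 hS (@majorized_expRN R) mS mexpN r01.
  under eq_Rintegral do rewrite expr1n !mul1r.
  congr (`|_ - _| <= _).
  rewrite (_ : parabolic_sum _ _ = parabolic_sum N.+1 (fun m j => mom m j * s (m + j.*2)%N)).
    rewrite -functional_momP momE (bigD1 ord0)//= coefC/= big1 ?addr0//.
    by move=> k; rewrite coefC -val_eqE/= => /negPf ->; rewrite mul0r.
  apply: eq_bigr => m _; apply: eq_bigr => j _.
  by rewrite sE expr1n; ring.
have c : (fun N => (1 / 2 : R) ^+ N.+1 * K) @ \oo --> (0 : R).
  rewrite -[X in _ --> X](mul0r K); apply: cvgM; last exact: cvg_cst.
  rewrite (cvg_shiftS (fun N => (1 / 2 : R) ^+ N)); apply: cvg_expr.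
  by rewrite ger0_norm; lra.
exact: (ler_cvg_to (cvg_cst _) c (nearW _ bound)).
Qed.

Lemma imaginary_continuation_cos kappa delta : 0 < delta ->
  (forall r, 0 < r < delta ->
    \int[mu]_w (G w * expR (r * a w + r ^+ 2 * b w)) = kappa) ->
  \int[mu]_w (G w * (cos (a w) * expR (- b w))) = kappa.
Proof.
move=> d0 hk.
rewrite (imaginary_continuation d0 hk (@majorized_cos R))/= ?mul1r ?mulr1//.
  exact: continuous_measurable_fun (@continuous_cos R).
by move=> m j; rewrite oddD odd_double addbF halfD odd_double andbF add0n doubleK exprD; ring.
Qed.

Lemma imaginary_continuation_sin kappa delta : 0 < delta ->
  (forall r, 0 < r < delta ->
    \int[mu]_w (G w * expR (r * a w + r ^+ 2 * b w)) = kappa) ->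
  \int[mu]_w (G w * (sin (a w) * expR (- b w))) = 0.
Proof.
move=> d0 hk.
rewrite (imaginary_continuation d0 hk (@majorized_sin R))/= ?mul0r ?mulr0//.
  exact: continuous_measurable_fun (@continuous_sin R).
case=> [|m] j; first by rewrite add0n odd_double !mul0r mulr0.
by rewrite addSn /= oddD odd_double addbF halfD odd_double andbF add0n doubleK exprD; ring.
Qed.

End continuation.

(** * Fourier transform of the Gaussian *)

Section gaussian1.
Context {R : realType}.
Local Notation leb := (@lebesgue_measure R).
Implicit Types (t x phi : R).

(** Completing the square reduces to the integral of [gauss_fun]. *)
Lemma integral_gaussian_exp t x : 0 < t ->
  (\int[leb]_s (expR (- (t * s ^+ 2) + x * s))%:E)%E =
  (Num.sqrt (pi / t) * expR (x ^+ 2 / (4 * t)))%:E.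
Proof.
move=> t0; have q0 : 0 < Num.sqrt t by rewrite sqrtr_gt0.
have qt : Num.sqrt t ^+ 2 = t by rewrite sqr_sqrtr// ltW.
have mg : measurable_fun setT (EFin \o (@gauss_fun R)).
  by apply/measurable_EFinP; exact: measurable_gauss_fun.
have H := @ge0_integral_affine R (Num.sqrt t) (x / (2 * Num.sqrt t))
  (fun s => (gauss_fun s)%:E) q0 mg.
rewrite integralT_gauss in H.
under eq_integral => s _.
  rewrite (_ : expR _ = expR (x ^+ 2 / (4 * t)) *
    gauss_fun (x / (2 * Num.sqrt t) - Num.sqrt t * s)).
    rewrite EFinM. over.
  rewrite /gauss_fun -expRD; congr expR.
  by rewrite -{1 2}qt; field; rewrite gt_eqF.
rewrite ge0_integralZl//; last 2 first.
- exact: (measurableT_comp mg (measurable_affine _ _)).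
- by move=> s _; rewrite lee_fin gauss_fun_ge0.
have -> : (\int[leb]_s (gauss_fun (x / (2 * Num.sqrt t) - Num.sqrt t * s))%:E)%E =
    (Num.sqrt (pi / t))%:E.
  have -> : Num.sqrt (pi / t) = (Num.sqrt t)^-1 * Num.sqrt pi.
    by rewrite sqrtrM ?pi_ge0// sqrtrV ?ltW// mulrC.
  rewrite EFinM H => [|s]; last by rewrite lee_fin gauss_fun_ge0.
  by rewrite muleA -EFinM mulVf ?gt_eqF// mul1e.
by rewrite -EFinM mulrC.
Qed.

Lemma measurable_gaussian_exp t x :
  measurable_fun setT (fun s : R => expR (- (t * s ^+ 2) + x * s)).
Proof.
apply: measurableT_comp => //; apply: measurable_funD; last exact: measurable_funM.
by apply: measurableT_comp => //; apply: measurable_funM => //; exact: measurable_funX.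
Qed.

Lemma integrable_gaussian_exp t x : 0 < t ->
  leb.-integrable setT (EFin \o (fun s => expR (- (t * s ^+ 2) + x * s))).
Proof.
move=> t0; apply/integrableP; split.
  by apply/measurable_EFinP; exact: measurable_gaussian_exp.
under eq_integral do rewrite /= ger0_norm ?expR_ge0//.
by rewrite integral_gaussian_exp// ltry.
Qed.

Lemma Rintegral_gaussian_exp t x : 0 < t ->
  \int[leb]_s expR (- (t * s ^+ 2) + x * s) =
  Num.sqrt (pi / t) * expR (x ^+ 2 / (4 * t)).
Proof. by move=> t0; rewrite /Rintegral integral_gaussian_exp. Qed.

Lemma measurable_gaussian t : measurable_fun setT (fun s : R => expR (- (t * s ^+ 2))).
Proof.
have := measurable_gaussian_exp t 0.
by under eq_fun do rewrite mul0r addr0.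
Qed.

Lemma integrable_gaussian t : 0 < t ->
  leb.-integrable setT (EFin \o (fun s => expR (- (t * s ^+ 2)))).
Proof.
move=> t0; have := integrable_gaussian_exp 0 t0.
by rewrite /comp; under eq_fun do rewrite mul0r addr0.
Qed.

(** By completing the square, the integral of
    [exp (- t s^2) * exp (r x s - r^2 x^2 / (4 t))] does not depend on [r]; the
    imaginary continuation of this identity is the Fourier transform.  The
    phase [phi] is what lets the formula be iterated over the coordinates. *)
Lemma gaussian_fourier_phase t x phi : 0 < t ->
  \int[leb]_s (expR (- (t * s ^+ 2)) * cos (x * s + phi)) =
  Num.sqrt (pi / t) * expR (- (x ^+ 2 / (4 * t))) * cos phi.
Proof.
move=> t0.
pose G (s : measurableTypeR R) : R := expR (- (t * s ^+ 2)).
pose a (s : measurableTypeR R) : R := x * s.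
pose b (s : measurableTypeR R) : R := - (x ^+ 2 / (4 * t)).
have mG : measurable_fun setT G by exact: measurable_gaussian.
have ma : measurable_fun setT a by exact: measurable_funM.
have mb : measurable_fun setT b by exact: measurable_cst.
have iE : leb.-integrable setT (EFin \o (fun s => G s * expR (2 * `|a s| + 4 * `|b s|))).
  pose c := expR (4 * `|- (x ^+ 2 / (4 * t))|).
  have i2 := integrable_addr (integrable_gaussian_exp (2 * x) t0)
    (integrable_gaussian_exp (- (2 * x)) t0).
  apply: dominated_integrable (integrable_scaler c i2) _.
    apply: measurable_funM => //; apply: measurableT_comp => //.
    apply: measurable_funD; apply: measurable_funM => //; exact: measurableT_comp.
  move=> s; rewrite ger0_norm ?mulr_ge0 ?expR_ge0//.
  rewrite expRD mulrA [leRHS]mulrC ler_wpM2r ?expR_ge0// /G -expRD.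
  have -> : 2 * `|a s| = `|2 * (x * s)| by rewrite [RHS]normrM ger0_norm.
  have [h|h] := leP 0 (2 * (x * s)).
    by rewrite ger0_norm// mulrA lerDl expR_ge0.
  by rewrite ltr0_norm// mulrA mulNr lerDr expR_ge0.
have hk r : 0 < r < 1 ->
    \int[leb]_s (G s * expR (r * a s + r ^+ 2 * b s)) = Num.sqrt (pi / t).
  move=> _.
  under eq_Rintegral => s _.
    rewrite (_ : G s * _ = expR (r ^+ 2 * (- (x ^+ 2 / (4 * t)))) *
      expR (- (t * s ^+ 2) + (r * x) * s)); last first.
      by rewrite /G /a /b -!expRD; congr expR; ring.
    over.
  rewrite RintegralZl//; last exact: integrable_gaussian_exp.
  rewrite Rintegral_gaussian_exp// mulrCA -expRD.
  by rewrite (_ : _ + _ = 0) ?expR0 ?mulr1//; field; rewrite gt_eqF.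
have hc := imaginary_continuation_cos mG ma mb iE ltr01 hk.
have hs := imaginary_continuation_sin mG ma mb iE ltr01 hk.
have e0 : expR (x ^+ 2 / (4 * t)) != 0 by rewrite gt_eqF ?expR_gt0.
have iG (S : R -> R) : measurable_fun setT S -> (forall y, `|S y| <= 1) ->
    leb.-integrable setT (EFin \o (fun s => G s * S (a s))).
  move=> mS S1; apply: dominated_integrable (integrable_gaussian t0) _.
    by apply: measurable_funM => //; exact: measurableT_comp.
  by move=> s; rewrite normrM ger0_norm ?expR_ge0// ler_piMr ?expR_ge0.
have mcos := continuous_measurable_fun (@continuous_cos R).
have msin := continuous_measurable_fun (@continuous_sin R).
have ic := iG cos mcos (fun y => ltac:(by rewrite ler_norml cos_geN1 cos_le1)).
have is' := iG sin msin (fun y => ltac:(by rewrite ler_norml sin_geN1 sin_le1)).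
have pull (S : R -> R) : leb.-integrable setT (EFin \o (fun s => G s * S (a s))) ->
    \int[leb]_s (G s * (S (a s) * expR (- b s))) =
    expR (x ^+ 2 / (4 * t)) * \int[leb]_s (G s * S (a s)).
  move=> iS; rewrite -RintegralZl//; apply: eq_Rintegral => s _.
  by rewrite /b opprK; ring.
rewrite pull// in hc; rewrite pull// in hs.
have {}hs : \int[leb]_s (G s * sin (a s)) = 0.
  by apply/eqP; move/eqP: hs; rewrite mulf_eq0 (negPf e0).
under eq_Rintegral => s _ do rewrite cosD mulrBr [X in X - _]mulrA [X in _ - X]mulrA.
rewrite RintegralB//; last 2 first.
- exact: (integrableZr measurableT (cos phi) ic).
- exact: (integrableZr measurableT (sin phi) is').
rewrite !RintegralZr// -[\int[leb]_s _]/(\int[leb]_s (G s * cos (a s))).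
rewrite -[X in _ - X * _]/(\int[leb]_s (G s * sin (a s))) hs mul0r subr0.
by congr (_ * _); rewrite -hc expRN; field.
Qed.

End gaussian1.

Section gaussian_rV.
Context {R : realType}.

Lemma integrable_rVS n (f : 'rV[R]_n.+1 -> R) : measurable_fun setT f ->
  (@lebesgue_measure R \x lebesgue_rV n)%E.-integrable setT (EFin \o (f \o @cons_rV R n)) ->
  (lebesgue_rV n.+1).-integrable setT (EFin \o f).
Proof.
move=> mf /integrableP[mfc fc]; apply/integrableP; split; first exact/measurable_EFinP.
rewrite ge0_integral_rVS//; last first.
  by apply: measurableT_comp => //; exact/measurable_EFinP.
by rewrite fubini_tonelli1// in fc; exact: measurableT_comp.
Qed.

Lemma Rintegral_rVS n (f : 'rV[R]_n.+1 -> R) : measurable_fun setT f ->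
  (@lebesgue_measure R \x lebesgue_rV n)%E.-integrable setT (EFin \o (f \o @cons_rV R n)) ->
  \int[lebesgue_rV n.+1]_x f x =
  \int[lebesgue_measure]_a \int[lebesgue_rV n]_y f (cons_rV (a, y)).
Proof.
move=> mf ifc; rewrite (Rintegral_fubini1 ifc) /Rintegral /= /lebesgue_cons.
have := @integral_pushforward _ _ _ _ R _ (@measurable_cons_rV R n)
  (@lebesgue_measure R \x lebesgue_rV n)%E setT (EFin \o f).
rewrite preimage_setT => <- //.
exact/measurable_EFinP.
Qed.

Definition gaussian_rV n (t : R) (x : 'rV[R]_n) : R := expR (- (t * dotr x x)).

Lemma gaussian_cons n t a (y : 'rV[R]_n) :
  gaussian_rV t (cons_rV (a, y)) = expR (- (t * a ^+ 2)) * gaussian_rV t y.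
Proof. by rewrite /gaussian_rV dotr_cons -expRD; congr expR; ring. Qed.

Lemma measurable_gaussian_rV n t : measurable_fun setT (@gaussian_rV n t).
Proof.
apply: measurableT_comp => //; apply: measurableT_comp => //.
by apply: measurable_funM => //; exact: measurable_fun_dotr.
Qed.

Lemma integrable_gaussian_rV n t : 0 < t ->
  (lebesgue_rV n).-integrable setT (EFin \o @gaussian_rV n t).
Proof.
move=> t0; elim: n => [|n IHn].
  apply/integrableP; split; first by apply/measurable_EFinP; exact: measurable_gaussian_rV.
  rewrite /= integral_dirac//; last first.
    by apply/measurable_EFinP; apply: measurableT_comp => //; exact: measurable_gaussian_rV.
  by rewrite diracT mul1e ltry.
apply: integrable_rVS; first exact: measurable_gaussian_rV.
rewrite (_ : _ \o _ = EFin \o (fun z => expR (- (t * z.1 ^+ 2)) * gaussian_rV t z.2)).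
  exact: integrable_tensor (integrable_gaussian t0) IHn.
by apply/funext => -[a y] /=; rewrite gaussian_cons.
Qed.

Lemma integrable_gaussian_cos n t (x : 'rV[R]_n) phi : 0 < t ->
  (lebesgue_rV n).-integrable setT
    (EFin \o (fun s => gaussian_rV t s * cos (dotr x s + phi))).
Proof.
move=> t0; apply: dominated_integrable (integrable_gaussian_rV n t0) _.
  apply: measurable_funM; first exact: measurable_gaussian_rV.
  apply: (measurableT_comp (continuous_measurable_fun (@continuous_cos R))).
  by apply: measurable_funD => //; exact: measurable_fun_dotr.
move=> s; rewrite normrM ger0_norm ?expR_ge0// ler_piMr ?expR_ge0//.
by rewrite ler_norml cos_geN1 cos_le1.
Qed.

(** The outer variable acts on the inner integral as a phase. *)
Lemma gaussian_rV_fourier n t (x : 'rV[R]_n) phi : 0 < t ->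
  \int[lebesgue_rV n]_s (gaussian_rV t s * cos (dotr x s + phi)) =
  Num.sqrt (pi / t) ^+ n * expR (- (dotr x x / (4 * t))) * cos phi.
Proof.
move=> t0; elim: n x phi => [|n IHn] x phi.
  rewrite /Rintegral /= integral_dirac//; last first.
    exact: (measurable_int _ (integrable_gaussian_cos x phi t0)).
  rewrite diracT mul1e/= /gaussian_rV /dotr !big_ord0 mulr0 mul0r oppr0 expR0.
  by rewrite expr0 !mul1r add0r.
pose x' : 'rV[R]_n := \row_i x ord0 (lift ord0 i).
pose F (s : 'rV[R]_n.+1) := gaussian_rV t s * cos (dotr x s + phi).
have FE a y : F (cons_rV (a, y)) = expR (- (t * a ^+ 2)) *
    (gaussian_rV t y * cos (dotr x' y + (x ord0 ord0 * a + phi))).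
  by rewrite /F gaussian_cons dotr_consl mulrA; congr (_ * cos _); rewrite /x'; ring.
have mF : measurable_fun setT F.
  by apply/measurable_EFinP; exact: (measurable_int _ (integrable_gaussian_cos x phi t0)).
transitivity (\int[lebesgue_rV n.+1]_s F s); first by [].
rewrite (Rintegral_rVS mF); last first.
  have iT := integrable_tensor (integrable_gaussian t0) (integrable_gaussian_rV n t0).
  apply: dominated_integrable iT _.
    exact: (measurableT_comp mF (@measurable_cons_rV R n)).
  move=> -[a y] /=; rewrite FE mulrA normrM ger0_norm ?mulr_ge0 ?expR_ge0//.
  by rewrite ler_piMr ?mulr_ge0 ?expR_ge0// ler_norml cos_geN1 cos_le1.
under eq_Rintegral => a _.
  under eq_Rintegral => y _ do rewrite FE.
  rewrite RintegralZl//; last exact: integrable_gaussian_cos.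
  rewrite IHn mulrCA. over.
rewrite RintegralZl//; last first.
  apply: dominated_integrable (integrable_gaussian t0) _.
    apply: measurable_funM; first exact: measurable_gaussian.
    apply: (measurableT_comp (continuous_measurable_fun (@continuous_cos R))).
    by apply: measurable_funD => //; exact: measurable_funM.
  move=> s; rewrite normrM ger0_norm ?expR_ge0// ler_piMr ?expR_ge0//.
  by rewrite ler_norml cos_geN1 cos_le1.
rewrite gaussian_fourier_phase// (dotr_recl x) -/x' (exprS _ n).
rewrite [(_ + dotr _ _) / _]mulrDl opprD expRD.
ring.
Qed.

End gaussian_rV.

(** * The Weierstrass kernel and temperatures with Hölder data *)

Section weierstrass.
Context {R : realType} {n : nat}.
Local Notation spacetime := ('rV[R]_n * measurableTypeR R)%type.
Implicit Types (x y a : 'rV[R]_n) (t : R).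

(** [x^-1 = x * (x ^ 2)^-1], also at 0, and on nonnegative numbers inversion is
    a power function. *)
Lemma measurable_funV d (T : measurableType d) (f : T -> R) :
  measurable_fun setT f -> measurable_fun setT (fun w => (f w)^-1).
Proof.
move=> mf; rewrite (_ : (fun w => _) = (fun w => f w * (f w ^+ 2) `^ (-1))).
  apply: measurable_funM => //; apply: (measurableT_comp (measurable_powR (-1))).
  exact: measurable_funX.
apply/funext => w; rewrite powR_inv1 ?sqr_ge0//.
have [->|f0] := eqVneq (f w) 0; first by rewrite invr0 mul0r.
by rewrite expr2 invfM mulVKf.
Qed.

Lemma measurable_weierstrass :
  measurable_fun setT (fun z : spacetime => weierstrass z.1 z.2 : R).
Proof.
have m4 (c : R) : measurable_fun setT (fun z : spacetime => c * z.2).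
  exact: (measurable_funM (measurable_cst _) measurable_snd).
apply: measurable_funM.
  exact: (measurableT_comp (measurable_powR _) (m4 _)).
apply: measurableT_comp => //; apply: measurableT_comp => //.
apply: measurable_funM; last exact: measurable_funV.
under eq_fun do rewrite enorm_sqr.
by apply: measurable_fun_dotr.
Qed.

Lemma weierstrassE x t : 0 < t ->
  weierstrass x t = (Num.sqrt (4 * pi * t) ^+ n)^-1 * gaussian_rV (4 * t)^-1 x.
Proof.
move=> t0; have p0 : 0 < 4 * pi * t by rewrite !mulr_gt0// pi_gt0.
rewrite /weierstrass /gaussian_rV enorm_sqr; congr (_ * expR (- _)); last by rewrite mulrC.
rewrite powRN; congr (_^-1).
rewrite (mulrC n%:R) powRrM powR12_sqrt ?ltW//.
by rewrite powR_mulrn// sqrtr_ge0.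
Qed.

Lemma weierstrass_ge0 x t : 0 <= weierstrass x t.
Proof. by rewrite mulr_ge0 ?powR_ge0 ?expR_ge0. Qed.

Lemma weierstrass_fourier x t : 0 < t ->
  weierstrass x t = (2 * pi) ^- n *
    \int[lebesgue_rV n]_s (gaussian_rV t s * cos (dotr x s)).
Proof.
move=> t0; have p0 := pi_gt0 R.
have := gaussian_rV_fourier x 0 t0.
under eq_Rintegral do rewrite addr0.
move=> ->; rewrite cos0 mulr1 weierstrassE// /gaussian_rV mulrA -!exprVn -exprMn.
congr (_ ^+ n * expR (- _)); last by rewrite mulrC.
apply: (mulfI (_ : 2 * pi != 0)); first by rewrite gt_eqF// mulr_gt0.
rewrite mulVKf ?gt_eqF ?mulr_gt0//.
apply: (mulIf (_ : Num.sqrt (4 * pi * t) != 0)).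
  by rewrite gt_eqF// sqrtr_gt0 !mulr_gt0.
rewrite mulfVK ?gt_eqF ?sqrtr_gt0 ?mulr_gt0//.
rewrite -sqrtrM ?divr_ge0 ?ltW//.
have -> : pi / t * (4 * pi * t) = (2 * pi) ^+ 2 by field; rewrite gt_eqF.
by rewrite sqrtr_sqr ger0_norm// mulr_ge0// ltW.
Qed.

Lemma integral_weierstrass x t : 0 < t ->
  (\int[lebesgue_rV n]_a (weierstrass (x - a) t)%:E = 1)%E.
Proof.
move=> t0; have t40 : 0 < (4 * t)^-1 by rewrite invr_gt0 mulr_gt0.
have mW : measurable_fun setT (fun a : 'rV[R]_n => (weierstrass a t)%:E).
  by apply/measurable_EFinP; exact: (measurableT_comp measurable_weierstrass (pair2_measurable t)).
transitivity (\int[lebesgue_rV n]_a (weierstrass a t)%:E)%E.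
  rewrite [RHS](ge0_integral_rV_affine x ltr01 mW) => [|a].
    by rewrite expr1n mul1e; under [RHS]eq_integral do rewrite scale1r.
  by rewrite lee_fin weierstrass_ge0.
have := gaussian_rV_fourier (0 : 'rV[R]_n) 0 t40.
under eq_Rintegral do rewrite dotr0l addr0 cos0 mulr1.
rewrite dotr0l mul0r oppr0 expR0 cos0 !mulr1 invrK => H.
under eq_integral do rewrite weierstrassE// EFinM.
rewrite integralZl//; last exact: integrable_gaussian_rV.
have iF := integrable_fin_num measurableT (integrable_gaussian_rV n t40).
rewrite -(fineK iF) -EFinM; congr EFin.
rewrite -[fine _]/(\int[lebesgue_rV n]_s gaussian_rV (4 * t)^-1 s) H.
rewrite (_ : pi * (4 * t) = 4 * pi * t); last by ring.
by rewrite mulVf// expf_neq0// gt_eqF// sqrtr_gt0 !mulr_gt0// pi_gt0.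
Qed.

Lemma integrable_weierstrass x t : 0 < t ->
  (lebesgue_rV n).-integrable setT (EFin \o (fun a => weierstrass (x - a) t)).
Proof.
move=> t0; apply/integrableP; split.
  have ma : measurable_fun setT (fun a : 'rV[R]_n => (x - a, t : measurableTypeR R)).
    apply/measurable_fun_pairP; split; last exact: measurable_cst.
    have := @measurable_rV_affine R n 1 x.
    by under eq_fun do rewrite scale1r.
  by apply/measurable_EFinP; exact: (measurableT_comp measurable_weierstrass ma).
under eq_integral do rewrite /= ger0_norm ?weierstrass_ge0//.
by rewrite integral_weierstrass// ltry.
Qed.

Lemma Rintegral_weierstrass x t : 0 < t ->
  \int[lebesgue_rV n]_a weierstrass (x - a) t = 1.
Proof. by move=> t0; rewrite /Rintegral integral_weierstrass. Qed.

(** The moment is paid for by half of the Gaussian decay: with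
    [u = |x|^2 / (8 t)] one has [u * exp (- u) <= 1], and the remaining
    [exp (- u)] is, up to normalization, the kernel at time [2 t]. *)
Lemma weierstrass_moment x t : 0 < t ->
  weierstrass x t * enorm x ^+ 2 <=
  8 * Num.sqrt 2 ^+ n * t * weierstrass x (2 * t).
Proof.
move=> t0; have t20 : 0 < 2 * t by rewrite mulr_gt0.
rewrite !weierstrassE// enorm_sqr.
have -> : 4 * pi * (2 * t) = 2 * (4 * pi * t) by ring.
rewrite (sqrtrM _ (ler0n _ 2)) exprMn /gaussian_rV.
have q2 : Num.sqrt 2 ^+ n != 0 :> R by rewrite expf_neq0// gt_eqF// sqrtr_gt0.
have q4 : 0 < Num.sqrt (4 * pi * t) ^+ n.
  by rewrite exprn_gt0// sqrtr_gt0 !mulr_gt0// pi_gt0.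
set q := _ ^+ n in q4 *; set Q := _ ^+ n in q2 *.
set u := (4 * (2 * t))^-1 * dotr x x.
have -> : (4 * t)^-1 * dotr x x = u + u.
  by rewrite /u; field; rewrite gt_eqF.
rewrite opprD expRD.
have -> : 8 * Q * t * ((Q * q)^-1 * expR (- u)) = q^-1 * expR (- u) * (8 * t).
  by field; rewrite q2 gt_eqF.
have -> : q^-1 * (expR (- u) * expR (- u)) * dotr x x =
    q^-1 * expR (- u) * (8 * t) * (u * expR (- u)).
  by rewrite /u; field; rewrite !gt_eqF.
have c0 : 0 <= q^-1 * expR (- u) * (8 * t).
  by rewrite !mulr_ge0 ?expR_ge0 ?invr_ge0 ?ltW.
rewrite ler_piMr//.
rewrite expRN ler_pdivrMr ?expR_gt0// mul1r.
by apply: le_trans (expR_ge1Dx u); rewrite lerDr.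
Qed.

End weierstrass.

Section temperature_holder.
Context {R : realType} {n : nat} (gamma L : R) (f : 'rV[R]_n -> R).
Hypotheses (gamma0 : 0 < gamma) (gamma1 : gamma <= 1)
  (mf : measurable_fun setT f)
  (hf : forall x y, `|f x - f y| <= L * enorm (x - y) `^ gamma).

(** An interpolation between the powers 0 and 2, homogeneous in the length
    [tau]; it trades fractional moments for the second one. *)
Lemma powR_parabolic_le (s tau : R) : 0 <= s -> 0 < tau ->
  s `^ gamma <= tau `^ gamma * (1 + s ^+ 2 / tau ^+ 2).
Proof.
move=> s0 tau0.
have -> : s = tau * (s / tau) by field; rewrite gt_eqF.
have h0 : 0 <= s / tau by rewrite divr_ge0// ltW.
rewrite (powRM _ (ltW tau0) h0) ler_wpM2l ?powR_ge0//.
have -> : (tau * (s / tau)) ^+ 2 / tau ^+ 2 = (s / tau) ^+ 2.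
  by field; rewrite gt_eqF.
have [h1|h1] := leP (s / tau) 1.
  apply: (@le_trans _ _ 1); last by rewrite lerDl sqr_ge0.
  by rewrite -(congr1 (@^~ gamma) (@powR1 R)) ge0_ler_powR ?nnegrE// ltW.
apply: (@le_trans _ _ (s / tau)); first exact: (ler1_powR (ltW h1)).
apply: (@le_trans _ _ ((s / tau) ^+ 2)); last by rewrite lerDr.
by rewrite expr2 ler_peMl// ltW.
Qed.

(** [L] multiplies the positive distance between two distinct points. *)
Lemma holder_const_ge0 : (0 < n)%N -> 0 <= L.
Proof.
case: n f mf hf => // m g _ hg _.
have := hg (const_mx 1) 0; rewrite subr0 => h.
have := le_trans (normr_ge0 _) h; rewrite pmulr_lge0// powR_gt0//.
rewrite /enorm sqrtr_gt0; under eq_bigr do rewrite mxE expr1n.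
by rewrite sumr_const card_ord ltr0n.
Qed.

(** The length [tau] is free: for [tau ^ 2] of the order of [t] the bound is of
    the order of [L * t `^ (gamma / 2)]. *)
Lemma temperature_near_datum x t tau : (0 < n)%N -> 0 <= t -> 0 < tau ->
  `|temperature f (x, t) - f x| <=
  L * tau `^ gamma * (1 + 8 * Num.sqrt 2 ^+ n * t / tau ^+ 2).
Proof.
move=> n0; have L0 := holder_const_ge0 n0; rewrite le_eqVlt => /predU1P[<-|t0] tau0.
  by rewrite /temperature/= eqxx subrr normr0 mulr0 mul0r addr0 mulr1 mulr_ge0 ?powR_ge0.
rewrite /temperature/= gt_eqF//.
have t20 : 0 < 2 * t by rewrite mulr_gt0.
pose c := 8 * Num.sqrt 2 ^+ n * t / tau ^+ 2.
pose B (a : 'rV[R]_n) := L * tau `^ gamma *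
   (weierstrass (x - a) t + c * weierstrass (x - a) (2 * t)).
have iW := integrable_weierstrass x t0; have iW2 := integrable_weierstrass x t20.
have iB : (lebesgue_rV n).-integrable setT (EFin \o B).
  by apply: integrable_scaler; apply: integrable_addr => //; exact: integrable_scaler.
have mW : measurable_fun setT (fun a : 'rV[R]_n => weierstrass (x - a) t : R).
  by apply/measurable_EFinP; exact: (measurable_int _ iW).
have WB a : `|weierstrass (x - a) t * (f a - f x)| <= B a.
  rewrite normrM ger0_norm ?weierstrass_ge0//.
  apply: (@le_trans _ _ (weierstrass (x - a) t *
    (L * (tau `^ gamma * (1 + enorm (x - a) ^+ 2 / tau ^+ 2))))).
    rewrite ler_wpM2l ?weierstrass_ge0// distrC; apply: le_trans (hf _ _) _.
    by rewrite ler_wpM2l// powR_parabolic_le ?sqrtr_ge0.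
  rewrite (_ : _ * _ = L * tau `^ gamma *
    (weierstrass (x - a) t + weierstrass (x - a) t * enorm (x - a) ^+ 2 / tau ^+ 2));
    last by ring.
  rewrite /B ler_wpM2l ?mulr_ge0 ?powR_ge0// lerD2l /c [leRHS]mulrAC.
  rewrite ler_wpM2r ?invr_ge0 ?sqr_ge0//.
  exact: weierstrass_moment.
have iWf : (lebesgue_rV n).-integrable setT
    (EFin \o (fun a : 'rV[R]_n => weierstrass (x - a) t * (f a - f x))).
  apply: dominated_integrable iB WB.
  by apply: measurable_funM => //; exact: measurable_funB.
have iWx : (lebesgue_rV n).-integrable setT
    (EFin \o (fun a : 'rV[R]_n => f x * weierstrass (x - a) t)) by exact: integrable_scaler.
have -> : \int[lebesgue_rV n]_y (weierstrass (x - y) t * f y) =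
    \int[lebesgue_rV n]_a (weierstrass (x - a) t * (f a - f x)) + f x.
  have fE : \int[lebesgue_rV n]_a (f x * weierstrass (x - a) t) = f x.
    by rewrite RintegralZl// Rintegral_weierstrass// mulr1.
  rewrite -[X in _ = _ + X]fE -RintegralD//.
  by apply: eq_Rintegral => a _; ring.
rewrite addrK; apply: (le_trans (le_normr_Rintegral measurableT iWf)).
have -> : L * tau `^ gamma * (1 + 8 * Num.sqrt 2 ^+ n * t / tau ^+ 2) =
    \int[lebesgue_rV n]_a B a.
  rewrite RintegralZl//; last by apply: integrable_addr => //; exact: integrable_scaler.
  rewrite RintegralD//; last exact: integrable_scaler.
  by rewrite (Rintegral_weierstrass x t0) RintegralZl// (Rintegral_weierstrass x t20) mulr1.
by apply: le_Rintegral => //; exact: (integrable_norm iWf).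
Qed.

End temperature_holder.

(** * Mean values of temperatures at every scale *)

(** The same measure, packaged with its sigma-finiteness as Fubini's theorem
    requires. *)
Definition spacetime_sigma_finite (R : realType) (n : nat) :
    {sigma_finite_measure set ('rV[R]_n * measurableTypeR R)%type -> \bar R} :=
  HB.pack (Measure.sort (@spacetime_measure R n))
    (Measure.class (@spacetime_measure R n))
    (@Measure_isSigmaFinite.Build _ _ R (@spacetime_measure R n)
      (product_sigma_finite (lebesgue_rV n) (@lebesgue_measure R))).

(** What is used of a parabolic mean value kernel, for a Borel representative
    [G]: it lives in times [0 <= t <= T] and in the ball of radius [A], and
    [bk_mean_value] is the mean value formula at the origin for the temperature
    [exp (xi . x + |xi|^2 t)], valid for small scales. *)
Record borel_kernel (R : realType) (n : nat) (A T : R)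
    (G : 'rV[R]_n * measurableTypeR R -> R) : Prop := {
  bk_measurable : measurable_fun setT G ;
  bk_ge0 : forall w, 0 <= G w ;
  bk_integrable : (@spacetime_measure R n).-integrable setT (EFin \o G) ;
  bk_int1 : \int[@spacetime_measure R n]_w G w = 1 ;
  bk_supp : forall w, G w != 0 -> 0 <= w.2 <= T /\ enorm w.1 <= A ;
  bk_mean_value : forall xi : 'rV[R]_n, exists2 d, 0 < d & forall r, 0 < r < d ->
    \int[@spacetime_measure R n]_w (G w *
      expR (r * - dotr xi w.1 + r ^+ 2 * - (dotr xi xi * w.2))) = 1 }.

Section mean_value.
Context {R : realType} {n : nat} (A T : R) (G : 'rV[R]_n * measurableTypeR R -> R).
Hypothesis KG : borel_kernel A T G.
Local Notation spacetime := ('rV[R]_n * measurableTypeR R)%type.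
Local Notation mu := (@spacetime_measure R n).
Local Notation smu := (@spacetime_sigma_finite R n).
Let mG := bk_measurable KG.
Let G0 := bk_ge0 KG.
Let iG := bk_integrable KG.

Lemma kernel_integrable (h : spacetime -> R) (M : R) :
  measurable_fun setT h -> (forall w, G w != 0 -> `|h w| <= M) ->
  mu.-integrable setT (EFin \o (fun w => G w * h w)).
Proof.
move=> mh hM; apply: dominated_integrable (integrable_scaler M iG) _.
  exact: measurable_funM.
move=> w; rewrite normrM ger0_norm// mulrC.
have [->|Gw] := eqVneq (G w) 0; first by rewrite !mulr0.
by rewrite ler_wpM2r// hM.
Qed.

Lemma kernel_height_ge0 : 0 <= T.
Proof.
rewrite leNgt; apply/negP => T0.
have : \int[mu]_w G w = 0.
  rewrite (eq_Rintegral _ (g := fun=> 0)) ?(Rintegral_cst _ measurableT) ?mul0r// => w _.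
  apply/eqP; apply: contraT => /(bk_supp KG)[/andP[h1 h2] _].
  by have := le_trans h1 h2; rewrite leNgt T0.
by rewrite (bk_int1 KG) => /eqP; rewrite oner_eq0.
Qed.

(** A change of scale by [r] amounts to replacing [xi] by [r xi], so the
    continuation at scale 1 for all frequencies gives all scales.  The cosine
    at a general point is expanded by the addition formula, the sine part of
    the average being 0. *)
Lemma kernel_fourier (xi x : 'rV[R]_n) (t r : R) : 0 < r ->
  \int[mu]_w (G w * (gaussian_rV (t - r ^+ 2 * w.2) xi *
     cos (dotr (x - r *: w.1) xi))) = gaussian_rV t xi * cos (dotr x xi).
Proof.
move=> r0; pose eta := r *: xi.
pose a (w : spacetime) := - dotr eta w.1.
pose b (w : spacetime) := - (dotr eta eta * w.2).
have ma : measurable_fun setT a.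
  by apply: measurableT_comp => //; exact: measurable_fun_dotr.
have mb : measurable_fun setT b.
  by apply: measurableT_comp => //; exact: measurable_funM.
pose M := expR (2 * (\sum_i `|eta ord0 i| * A) + 4 * (dotr eta eta * T)).
have iE : mu.-integrable setT (EFin \o (fun w => G w * expR (2 * `|a w| + 4 * `|b w|))).
  apply: (@kernel_integrable _ M).
    apply: measurableT_comp => //; apply: measurable_funD;
      by apply: measurable_funM => //; exact: measurableT_comp.
  move=> w /(bk_supp KG)[/andP[s0 sT] yA].
  rewrite ger0_norm ?expR_ge0// ler_expR lerD// ler_wpM2l//.
    rewrite normrN (le_trans (ler_norm_sum _ _ _))//; apply: ler_sum => i _.
    rewrite normrM ler_wpM2l// (le_trans _ yA)// /enorm -sqrtr_sqr ler_wsqrtr//.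
    by rewrite (bigD1 i)//= lerDl sumr_ge0// => j _; exact: sqr_ge0.
  by rewrite normrN normrM (ger0_norm (dotr_ge0 _)) ger0_norm// ler_wpM2l// dotr_ge0.
have [d d0 hd] := bk_mean_value KG eta.
have hc := imaginary_continuation_cos mG ma mb iE d0 hd.
have hs := imaginary_continuation_sin mG ma mb iE d0 hd.
have mE : measurable_fun setT (fun w => expR (- b w)).
  by apply: measurableT_comp => //; exact: measurableT_comp.
have iS (S : R -> R) : measurable_fun setT S -> (forall y, `|S y| <= 1) ->
    mu.-integrable setT (EFin \o (fun w => G w * (S (a w) * expR (- b w)))).
  move=> mS S1; apply: (dominated_integrable _ iE).
    by apply: measurable_funM => //; apply: measurable_funM => //; exact: measurableT_comp.
  move=> w; rewrite normrM ger0_norm// ler_wpM2l// normrM (ger0_norm (expR_ge0 _)).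
  apply: (@le_trans _ _ (expR (- b w))); first by rewrite ler_piMl ?expR_ge0.
  rewrite ler_expR (le_trans (ler_norm _))// normrN.
  have := normr_ge0 (a w); have := normr_ge0 (b w); lra.
have ic := iS cos (continuous_measurable_fun (@continuous_cos R))
  (fun y => ltac:(by rewrite ler_norml cos_geN1 cos_le1)).
have is' := iS sin (continuous_measurable_fun (@continuous_sin R))
  (fun y => ltac:(by rewrite ler_norml sin_geN1 sin_le1)).
pose c1 := gaussian_rV t xi * cos (dotr x xi).
pose c2 := gaussian_rV t xi * sin (dotr x xi).
transitivity (\int[mu]_w (c1 * (G w * (cos (a w) * expR (- b w))) -
   c2 * (G w * (sin (a w) * expR (- b w))))).
  apply: eq_Rintegral => w _.
  have -> : gaussian_rV (t - r ^+ 2 * w.2) xi = gaussian_rV t xi * expR (- b w).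
    rewrite /gaussian_rV -expRD; congr expR; rewrite /b /eta dotrZl dotrZr; ring.
  have -> : dotr (x - r *: w.1) xi = dotr x xi + a w.
    by rewrite dotrBl dotrZl /a /eta dotrZl (dotrC w.1).
  by rewrite cosD /c1 /c2; ring.
rewrite RintegralB//; [|exact: integrable_scaler|exact: integrable_scaler].
by rewrite !RintegralZl// hc hs mulr0 subr0 mulr1.
Qed.

(** The hypothesis keeps all the averaged times above the positive number
    [t - T * r ^+ 2]; the Fourier representation then converges absolutely and
    uniformly, and Fubini applies to the formula at each frequency. *)
Lemma kernel_weierstrass (x : 'rV[R]_n) (t r : R) : 0 < r -> T * r ^+ 2 < t ->
  \int[mu]_w (G w * weierstrass (x - r *: w.1) (t - r ^+ 2 * w.2)) = weierstrass x t.
Proof.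
move=> r0 Tt; have r20 : 0 < r ^+ 2 by exact: exprn_gt0.
have tpos w : G w != 0 -> t - T * r ^+ 2 <= t - r ^+ 2 * w.2.
  by move=> /(bk_supp KG)[/andP[_ sT] _]; rewrite lerD2l lerN2 mulrC ler_wpM2r// ltW.
have t0 : 0 < t - T * r ^+ 2 by rewrite subr_gt0.
have T0 := kernel_height_ge0.
have tt : 0 < t by rewrite (le_lt_trans _ Tt)// mulr_ge0// ltW.
pose F (z : spacetime * 'rV[R]_n) := G z.1 *
  (gaussian_rV (t - r ^+ 2 * z.1.2) z.2 * cos (dotr (x - r *: z.1.1) z.2)).
have iF : (smu \x lebesgue_rV n)%E.-integrable setT (EFin \o F).
  have iT := @integrable_tensor _ _ _ _ R smu (lebesgue_rV n) _ _ iG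
    (integrable_gaussian_rV n t0).
  apply: (dominated_integrable _ iT).
    have mG1 := measurableT_comp mG (@measurable_fst _ _ spacetime 'rV[R]_n).
    have m11 := measurableT_comp (@measurable_fst _ _ 'rV[R]_n (measurableTypeR R))
       (@measurable_fst _ _ spacetime 'rV[R]_n).
    have m12 := measurableT_comp (@measurable_snd _ _ 'rV[R]_n (measurableTypeR R))
       (@measurable_fst _ _ spacetime 'rV[R]_n).
    apply: measurable_funM => //; apply: measurable_funM.
      apply: measurableT_comp => //; apply: measurableT_comp => //.
      apply: measurable_funM; last exact: measurable_fun_dotr.
      apply: measurable_funB => //; exact: measurable_funM.
    apply: (measurableT_comp (continuous_measurable_fun (@continuous_cos R))).
    apply: measurable_fun_dotr => //.
    exact: (measurableT_comp (@measurable_rV_affine R n r x) m11).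
  move=> [w s] /=; rewrite normrM ger0_norm//.
  have [->|Gw] := eqVneq (G w) 0; first by rewrite !mul0r.
  rewrite ler_wpM2l// normrM ger0_norm ?expR_ge0//.
  apply: (@le_trans _ _ (gaussian_rV (t - r ^+ 2 * w.2) s)).
    by rewrite ler_piMr ?expR_ge0// ler_norml cos_geN1 cos_le1.
  by rewrite ler_expR lerN2 ler_wpM2r ?dotr_ge0 ?tpos.
have ex := Rintegral_exchange iF.
rewrite (weierstrass_fourier x tt).
under [in RHS]eq_Rintegral => s _ do rewrite -(kernel_fourier s x t r0).
rewrite -ex -RintegralZl//; last first.
  exact: (integrable_Rintegral1 iF).
apply: eq_Rintegral => w _.
have [Gw|Gw] := eqVneq (G w) 0.
  rewrite Gw mul0r /F/=; under eq_Rintegral do rewrite Gw mul0r.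
  by rewrite (Rintegral_cst _ measurableT) mul0r mulr0.
rewrite weierstrass_fourier ?(lt_le_trans t0 (tpos w Gw))//.
rewrite /F/= RintegralZl//; last first.
  have := integrable_gaussian_cos (x - r *: w.1) 0 (lt_le_trans t0 (tpos w Gw)).
  by rewrite /comp; under eq_fun do rewrite addr0.
by rewrite mulrCA.
Qed.

(** Fubini again, now between the average and the convolution with [f]. *)
Lemma kernel_temperature (f : 'rV[R]_n -> R) (M : R) (x : 'rV[R]_n) (t r : R) :
  measurable_fun setT f -> (forall y, `|f y| <= M) -> 0 < r -> T * r ^+ 2 < t ->
  mu.-integrable setT (EFin \o (fun w => G w * temperature f (backshift r (x, t) w))) /\
  \int[mu]_w (G w * temperature f (backshift r (x, t) w)) = temperature f (x, t).
Proof.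
move=> mf fM r0 Tt; have r20 : 0 < r ^+ 2 by exact: exprn_gt0.
have t0 : 0 < t - T * r ^+ 2 by rewrite subr_gt0.
have tpos w : G w != 0 -> 0 < t - r ^+ 2 * w.2.
  move=> /(bk_supp KG)[/andP[_ sT] _]; apply: lt_le_trans t0 _.
  by rewrite lerD2l lerN2 mulrC ler_wpM2r// ltW.
pose W (z : spacetime * 'rV[R]_n) : R :=
  weierstrass (x - r *: z.1.1 - z.2) (t - r ^+ 2 * z.1.2).
have W0 z : 0 <= W z by exact: weierstrass_ge0.
have mW : measurable_fun setT W.
  have m1 := measurableT_comp (@measurable_backshift R n r (x, t))
    (@measurable_fst _ _ spacetime 'rV[R]_n).
  have mz : measurable_fun setT (fun z : spacetime * 'rV[R]_n =>
      ((backshift r (x, t) z.1).1 - z.2, (backshift r (x, t) z.1).2)).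
    apply/measurable_fun_pairP; split; last exact: (measurableT_comp measurable_snd m1).
    apply: measurable_rV_sub => //; exact: (measurableT_comp measurable_fst m1).
  exact: (measurableT_comp measurable_weierstrass mz).
have iGW : (smu \x lebesgue_rV n)%E.-integrable setT (EFin \o (fun z => G z.1 * W z)).
  apply/integrable12ltyP.
    by apply/measurable_EFinP; apply: measurable_funM => //; exact: (measurableT_comp mG).
  under eq_integral => w _.
    rewrite (_ : integral _ _ _ = (G w)%:E); last first.
      under eq_integral => a _.
        rewrite (_ : `|_|%E = ((G w)%:E * (W (w, a))%:E)%E); last first.
          by rewrite -EFinM /= ger0_norm// mulr_ge0.
        over.
      have [->|Gw] := eqVneq (G w) 0.
        by under eq_integral do rewrite mul0e; rewrite integral0.
      have WE : (fun a => W (w, a)) =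
          (fun a => weierstrass (x - r *: w.1 - a) (t - r ^+ 2 * w.2)) by [].
      have iWw : (lebesgue_rV n).-integrable setT (EFin \o (fun a => W (w, a))).
        by rewrite WE; exact: (integrable_weierstrass (x - r *: w.1) (tpos w Gw)).
      rewrite (integralZl measurableT iWw).
      have -> : (\int[lebesgue_rV n]_a (W (w, a))%:E = 1)%E.
        exact: (integral_weierstrass (x - r *: w.1) (tpos w Gw)).
      by rewrite mule1.
    over.
  exact: (integrable_lty measurableT iG).
pose F (z : spacetime * 'rV[R]_n) := G z.1 * W z * f z.2.
have iF : (smu \x lebesgue_rV n)%E.-integrable setT (EFin \o F).
  apply: (dominated_integrable _ (integrable_scaler M iGW)).
    apply: measurable_funM; last exact: (measurableT_comp mf).
    by apply: measurable_funM => //; exact: (measurableT_comp mG).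
  have GW0 z : 0 <= G z.1 * W z by rewrite mulr_ge0.
  by move=> z; rewrite normrM (ger0_norm (GW0 z)) mulrC ler_wpM2r.
have FE w : \int[lebesgue_rV n]_a F (w, a) =
    G w * temperature f (backshift r (x, t) w).
  rewrite /F/=; have [->|Gw] := eqVneq (G w) 0.
    under eq_Rintegral do rewrite !mul0r.
    by rewrite (Rintegral_cst _ measurableT) !mul0r.
  have tw := tpos w Gw.
  rewrite /temperature /backshift/= gt_eqF//.
  under eq_Rintegral do rewrite -mulrA.
  rewrite RintegralZl//.
  have iw := integrable_weierstrass (x - r *: w.1) tw.
  apply: (dominated_integrable _ (integrable_scaler M iw)).
    apply: measurable_funM => //.
    by apply/measurable_EFinP; exact: (measurable_int _ iw).
  move=> a; rewrite normrM ger0_norm ?weierstrass_ge0// mulrC.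
  by rewrite ler_wpM2r// weierstrass_ge0.
split.
  have := integrable_Rintegral1 iF.
  by rewrite /comp; under eq_fun do rewrite FE.
under eq_Rintegral do rewrite -FE.
rewrite (Rintegral_exchange iF).
have T0 := kernel_height_ge0.
have tt : 0 < t by rewrite (le_lt_trans _ Tt)// mulr_ge0// ltW.
rewrite /temperature/= gt_eqF//; apply: eq_Rintegral => a _.
rewrite /F/= RintegralZr//; last first.
  apply: (@kernel_integrable (fun w => W (w, a)) (Num.sqrt (4 * pi * (t - T * r ^+ 2)) ^+ n)^-1).
    exact: (measurableT_comp mW (pair2_measurable a)).
  move=> w Gw; rewrite ger0_norm// /W/= weierstrassE ?tpos//.
  apply: (@le_trans _ _ (Num.sqrt (4 * pi * (t - r ^+ 2 * w.2)) ^+ n)^-1).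
    rewrite ler_piMr ?invr_ge0 ?exprn_ge0 ?sqrtr_ge0//.
    by rewrite -expR0 ler_expR oppr_le0 mulr_ge0 ?dotr_ge0// invr_ge0 mulr_ge0// ltW// tpos.
  have p4 : 0 < 4 * pi :> R by rewrite mulr_gt0// pi_gt0.
  rewrite lef_pV2 ?posrE ?exprn_gt0 ?sqrtr_gt0 ?mulr_gt0 ?tpos ?pi_gt0//.
  rewrite lerXn2r ?nnegrE ?sqrtr_ge0// ler_wsqrtr// ler_wpM2l ?(ltW p4)//.
  by have /(bk_supp KG)[/andP[_ sT] _] := Gw; rewrite lerD2l lerN2 mulrC ler_wpM2r// ltW.
congr (_ * _); rewrite -(kernel_weierstrass (x - a) r0 Tt).
by apply: eq_Rintegral => w _; rewrite /W/= addrAC.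
Qed.

End mean_value.

(** * Comparison principle for the averaging operator *)

Section comparison.
Context {R : realType} {n : nat} (A T : R) (G : 'rV[R]_n * measurableTypeR R -> R).
Hypothesis KG : borel_kernel A T G.
Local Notation spacetime := ('rV[R]_n * measurableTypeR R)%type.
Local Notation mu := (@spacetime_measure R n).
Let mG := bk_measurable KG.
Let G0 := bk_ge0 KG.
Let iG := bk_integrable KG.

(** The factor by which averaging at scale [r] multiplies [exp (t / r^2)]; it
    is independent of [r]. *)
Definition discount : R := \int[mu]_w (G w * expR (- w.2)).

Lemma integrable_discount :
  mu.-integrable setT (EFin \o (fun w => G w * expR (- w.2))).
Proof.
apply: (kernel_integrable KG (M := 1)).
  by apply: measurableT_comp => //; exact: measurableT_comp.
move=> w /(bk_supp KG)[/andP[s0 _] _].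
by rewrite ger0_norm ?expR_ge0// -expR0 ler_expR oppr_le0.
Qed.

Lemma discount_ge0 : 0 <= discount.
Proof. by apply: Rintegral_ge0 => w _; rewrite mulr_ge0// expR_ge0. Qed.

Lemma time_slice_negligible : {ae mu, forall w : spacetime, w.2 <> 0}.
Proof.
have m0 : measurable ([set 0] : set (measurableTypeR R)) by exact: measurable_set1.
exists ([set: 'rV[R]_n] `*` [set 0 : measurableTypeR R]); split.
- exact: measurableX.
- have := product_measure1E (lebesgue_rV n) (@lebesgue_measure R) measurableT m0.
  move=> /= ->; have -> : lebesgue_measure [set (0 : R)] = 0%E by exact: lebesgue_measure_set1.
  by rewrite mule0.
by move=> w /= /contrapT.
Qed.

(** Equality would force the kernel to vanish at all positive times, hence
    almost everywhere, contrary to its integral being 1. *)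
Lemma discount_lt1 : discount < 1.
Proof.
pose h w := G w - G w * expR (- w.2).
have ih : mu.-integrable setT (EFin \o h) by exact: integrable_subr integrable_discount.
have h0 w : 0 <= h w.
  rewrite /h; have [->|Gw] := eqVneq (G w) 0; first by rewrite mul0r subrr.
  have /(bk_supp KG)[/andP[s0 _] _] := Gw.
  by rewrite subr_ge0 ler_piMr// -expR0 ler_expR oppr_le0.
have hE : \int[mu]_w h w = 1 - discount.
  by rewrite RintegralB ?(bk_int1 KG)//; exact: integrable_discount.
rewrite -subr_gt0 -hE lt_neqAle Rintegral_ge0// andbT eq_sym.
apply/negP => /eqP int0.
have mh : measurable_fun setT (EFin \o h) by exact: measurable_int ih.
have : (\int[mu]_w `|(EFin \o h) w|)%E = 0%E.
  under eq_integral do rewrite /= ger0_norm//.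
  by rewrite -(fineK (integrable_fin_num measurableT ih)) -[fine _]/(\int[mu]_w h w) int0.
move/(ae_eq_integral_abs mu measurableT mh) => ae0.
have : \int[mu]_w G w = 0.
  rewrite /Rintegral (integral_eq_ae (g := cst 0%E)) ?integral0//.
  apply: filterS2 ae0 time_slice_negligible => w /= /(_ I) [hw0] w2.
  congr EFin; apply/eqP; apply: contraT => Gw.
  have /(bk_supp KG)[/andP[s0 _] _] := Gw.
  move: hw0 => /eqP; rewrite /h -[X in X - _]mulr1 -mulrBr mulf_eq0 (negPf Gw)/= subr_eq0.
  rewrite eq_sym => /eqP; rewrite -[RHS]expR0 => /expR_inj/eqP.
  by rewrite oppr_eq0 => /eqP.
by rewrite (bk_int1 KG) => /eqP; rewrite oner_eq0.
Qed.

(** With [theta] the discount and [e = exp ((t - t0) / r^2)], the averaged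
    inequality improves a bound [(q / (1 - theta) + M theta^k) e] to the same
    bound with [k + 1]: the average of [e] is [theta e], the past contributes
    nothing positive, and [q + theta q / (1 - theta) = q / (1 - theta)].  A
    constant bound starts the iteration at [k = 0], as [e >= 1]. *)
Lemma comparison (D : spacetime -> R) (r t0 M q : R) : 0 < r -> 0 <= q ->
  (forall z, t0 <= z.2 -> D z <= M) ->
  (forall z, z.2 < t0 -> D z <= 0) ->
  (forall z, t0 <= z.2 ->
    mu.-integrable setT (EFin \o (fun w => G w * D (backshift r z w)))) ->
  (forall z, t0 <= z.2 -> D z <= q + \int[mu]_w (G w * D (backshift r z w))) ->
  forall z, t0 <= z.2 -> D z <= q / (1 - discount) * expR ((z.2 - t0) / r ^+ 2).
Proof.
move=> r0 q0 DM Dpast iD Dmean.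
have r20 : 0 < r ^+ 2 by exact: exprn_gt0.
have th0 : 0 < 1 - discount by rewrite subr_gt0 discount_lt1.
pose M' := Num.max M 0; have M0 : 0 <= M' by rewrite le_max lexx orbT.
pose c k := q / (1 - discount) + M' * discount ^+ k.
have c0 k : 0 <= c k.
  by rewrite addr_ge0// ?mulr_ge0 ?invr_ge0 ?exprn_ge0 ?discount_ge0 ?(ltW th0).
have step k z : t0 <= z.2 -> D z <= c k * expR ((z.2 - t0) / r ^+ 2).
  elim: k z => [|k IHk] z tz.
    apply: (@le_trans _ _ M'); first by rewrite le_max DM.
    have e1 : 1 <= expR ((z.2 - t0) / r ^+ 2).
      by rewrite -expR0 ler_expR divr_ge0 ?subr_ge0 ?(ltW r20).
    apply: (@le_trans _ _ (c 0%N)); last by rewrite ler_peMr.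
    by rewrite /c expr0 mulr1 lerDr divr_ge0 ?(ltW th0).
  set e := expR ((z.2 - t0) / r ^+ 2).
  have e1 : 1 <= e by rewrite -expR0 ler_expR divr_ge0 ?subr_ge0 ?(ltW r20).
  apply: (le_trans (Dmean z tz)).
  have -> : c k.+1 * e = q * e + c k * e * discount.
    rewrite /c exprS; field; exact: lt0r_neq0.
  apply: lerD; first by rewrite ler_peMr.
  rewrite -RintegralZl//; last exact: integrable_discount.
  apply: le_Rintegral => //; first exact: iD.
    by apply: integrable_scaler; exact: integrable_discount.
  move=> w _; rewrite mulrCA ler_wpM2l//.
  have -> : c k * e * expR (- w.2) = c k * expR (((backshift r z w).2 - t0) / r ^+ 2).
    by rewrite -mulrA -expRD; congr (_ * expR _); rewrite /backshift/=; field; rewrite gt_eqF.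
  have [tw|tw] := leP t0 (backshift r z w).2; first exact: IHk.
  by apply: (le_trans (Dpast _ tw)); rewrite mulr_ge0 ?expR_ge0.
move=> z tz.
have cvgc : c k * expR ((z.2 - t0) / r ^+ 2) @[k --> \oo] -->
    (q / (1 - discount) + M' * 0) * expR ((z.2 - t0) / r ^+ 2).
  apply: cvgM; last exact: cvg_cst.
  apply: cvgD; first exact: cvg_cst.
  apply: cvgM; first exact: cvg_cst.
  by apply: cvg_expr; rewrite ger0_norm ?discount_ge0 ?discount_lt1.
rewrite mulr0 addr0 in cvgc.
exact: (ler_cvg_to (cvg_cst _) cvgc (nearW _ (fun k => step k z tz))).
Qed.

End comparison.

(** * Borel representatives of parabolic mean value kernels *)

Section exponential_temperature.
Context {R : realType} {n : nat}.
Local Notation spacetime := ('rV[R]_n * R)%type.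
Implicit Types (xi : 'rV[R]_n) (z e : spacetime) (g : spacetime -> R).

(** Union of the lines through the origin. *)
Lemma connected_spacetime : connected [set: spacetime].
Proof.
pose L z : set spacetime := (fun s : R => s *: z) @` setT.
have -> : [set: spacetime] = \bigcup_(z in setT) L z.
  by apply/seteqP; split => z // _; exists z => //; exists 1; rewrite ?scale1r.
apply: bigcup_connected => [|z _].
  by exists 0 => z _; exists 0 => //; rewrite scale0r.
apply: connected_continuous_connected.
  by apply/connected_intervalP.
by apply: continuous_subspaceT => s; exact: scalel_continuous.
Qed.

(** Along [e] the function is an exponential of one real variable. *)
Lemma exp_along_derive g e z (c : R) :
  (forall h : R, g (h *: e + z) = g z * expR (h * c)) ->
  derivable g z e /\ 'D_e g z = c * g z.
Proof.
move=> ge; pose phi (h : R) := g z * expR (h * c).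
have phi' : is_derive (0 : R) 1 phi (g z * (c * expR (0 * c))).
  have d1 : is_derive (0 : R) 1 (fun h : R => h * c) c.
    have := @is_deriveZ R R R id c 0 1 1 (is_derive_id _ _).
    rewrite /GRing.scale/= mulr1; congr (is_derive _ _ _ _).
    by apply/funext => h; rewrite /= mulrC.
  have d2 := @is_derive1_comp R expR (fun h => h * c) 0 _ _ (is_derive_expR (0 * c)) d1.
  have := @is_deriveZ R R R _ (g z) 0 1 _ d2.
  by rewrite /GRing.scale/= [expR _ * c]mulrC.
have qE : (fun h : R => h^-1 *: ((g \o shift z) (h *: e) - g z)) =
   (fun h : R => h^-1 *: ((phi \o shift 0) (h *: (1 : R)) - phi 0)).
  apply/funext => h; rewrite /= /phi mul0r expR0 mulr1 addr0 ge.
  by rewrite /GRing.scale/= mulr1.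
have [ex vl] := phi'.
rewrite mul0r expR0 mulr1 mulrC in vl.
split; first by rewrite /derivable qE.
by rewrite /derive qE.
Qed.

Definition exp_temperature xi z : R := expR (dotr xi z.1 + dotr xi xi * z.2).

Lemma exp_temperatureE xi h e z : exp_temperature xi (h *: e + z) =
  exp_temperature xi z * expR (h * (dotr xi e.1 + dotr xi xi * e.2)).
Proof.
rewrite /exp_temperature -expRD /=; congr expR.
by rewrite dotrDr dotrZr /GRing.scale/=; ring.
Qed.

Lemma continuous_exp_temperature xi : continuous (exp_temperature xi).
Proof.
move=> z; apply: continuous_comp; last exact: continuous_expR.
apply: cvgD; last by apply: cvgM; [exact: cvg_cst|exact: cvg_snd].
apply: (@cvg_comp _ _ _ fst (dotr xi)); last exact: continuous_dotr.
exact: cvg_fst.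
Qed.

Lemma heat_solution_exp_temperature xi :
  heat_solution [set: spacetime] (exp_temperature xi).
Proof.
have cv := @continuous_exp_temperature xi.
have along e (k : R) z : derivable (fun y => k * exp_temperature xi y) z e /\
   'D_e (fun y => k * exp_temperature xi y) z =
     (dotr xi e.1 + dotr xi xi * e.2) * (k * exp_temperature xi z).
  by apply: exp_along_derive => h; rewrite exp_temperatureE mulrA.
have along1 e z : derivable (exp_temperature xi) z e /\
   'D_e (exp_temperature xi) z = (dotr xi e.1 + dotr xi xi * e.2) * exp_temperature xi z.
  by apply: exp_along_derive => h; rewrite exp_temperatureE.
have D1 e : 'D_e (exp_temperature xi) =
    (fun y => (dotr xi e.1 + dotr xi xi * e.2) * exp_temperature xi y).
  by apply/funext => z; have [] := along1 e z.
have D2 e (k : R) : 'D_e (fun y => k * exp_temperature xi y) =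
    (fun y => (dotr xi e.1 + dotr xi xi * e.2) * (k * exp_temperature xi y)).
  by apply/funext => z; have [] := along e k z.
have ck (k : R) z : {for z, continuous (fun y => k * exp_temperature xi y)}.
  by apply: cvgM; [exact: cvg_cst|exact: cv].
have dx i : dotr xi (e_x i : spacetime).1 + dotr xi xi * (e_x i : spacetime).2 = xi ord0 i.
  rewrite /= mulr0 addr0 /dotr (bigD1 i)//= mxE !eqxx mulr1 big1 ?addr0// => j ji.
  by rewrite mxE (negPf ji) andbF mulr0.
split=> [z _|z _].
  split.
  - exact: cv.
  - by split; [have [] := along1 e_t z|rewrite D1; exact: ck].
  - by move=> i; split; [have [] := along1 (e_x i) z|rewrite D1; exact: ck].
  move=> i j; rewrite D1; split; first by have [] :=
    along (e_x j) (dotr xi (e_x i : spacetime).1 + dotr xi xi * (e_x i : spacetime).2) z.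
  by rewrite D2; apply: cvgM; [exact: cvg_cst|exact: ck].
have [_ ->] := along1 e_t z.
rewrite /= dotrC dotr0l add0r mulr1 {1}/dotr mulr_suml; apply: eq_bigr => i _.
rewrite D1; have [_ ->] :=
  along (e_x i) (dotr xi (e_x i : spacetime).1 + dotr xi xi * (e_x i : spacetime).2) z.
by rewrite !dx mulrA.
Qed.

End exponential_temperature.

Section borel_representative.
Context {R : realType} {n : nat}.
Local Notation spacetime := ('rV[R]_n * measurableTypeR R)%type.
Local Notation mu := (@spacetime_measure R n).

(** [G] is the positive part of a Borel function equal to the kernel almost
    everywhere, cut off outside a box containing the support of the kernel. *)
Lemma mean_value_kernel_borel (H : spacetime -> R) : mean_value_kernel H ->
  exists A T G, borel_kernel A T G /\ {ae mu, forall w, H w = G w}.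
Proof.
move=> HH.
have aeF : Filter (almost_everywhere mu) by exact: ae_filter_ringOfSetsType.
have [g ig Hg] := mvk_integrable HH.
have [M [Mr HM]] := compact_bounded (mvk_compact HH).
have {Mr} : exists2 M0 : R, 0 <= M0 & forall z : spacetime,
    supp H z -> `|z : 'rV[R]_n * R| <= M0.
  exists (Num.max M 0 + 1); first by rewrite addr_ge0// le_max lexx orbT.
  by move=> z; apply: HM; rewrite (le_lt_trans (_ : M <= Num.max M 0)) ?le_max ?lexx// ltrDl.
move=> {M HM} [M1 M10 HM]; pose M := M1 + 1.
have M0 : 0 <= M by rewrite addr_ge0.
pose B : set spacetime :=
  [set x : 'rV[R]_n | forall i, (`[- M, M]%classic : set (measurableTypeR R)) (x ord0 i)]
  `*` (`[0, M]%classic : set (measurableTypeR R)).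
have mB : measurable B.
  apply: measurableX => //.
  by apply: (measurable_rV_box (A := fun=> `[- M, M]%classic)).
have HB z : H z != 0 -> B z.
  move=> Hz; have sz : supp H z by exact: subset_closure.
  have [[_ b1] b2] : ball (0 : 'rV[R]_n * R) M z.
    by rewrite -ball_normE /ball_/= sub0r normrN (le_lt_trans (HM z sz))// ltrDl.
  split => /= [i|].
    have := b1 ord0 i; rewrite /ball/= mxE sub0r normrN => /ltW.
    by rewrite in_itv/= ler_norml.
  move: b2; rewrite /ball/= sub0r normrN => /ltW; rewrite ler_norml in_itv/= => /andP[_ ->].
  by rewrite andbT; exact: (mvk_supp HH sz).
pose G (z : spacetime) : R := \1_B z * Num.max (g z) 0.
have mg : measurable_fun setT g by apply/measurable_EFinP; exact: measurable_int ig.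
have mG : measurable_fun setT G.
  by apply: measurable_funM => //; exact: measurable_maxr.
have HG : {ae mu, forall w, H w = G w}.
  apply: (@filterS _ _ aeF) Hg => w Hw; rewrite /G -Hw (max_idPl (mvk_ge0 HH w)) indicE.
  have [//|/negP wB] := boolP (w \in B); first by rewrite mul1r.
  rewrite mul0r; apply/eqP; apply: contraT => /HB Bw.
  by exfalso; apply: wB; rewrite inE.
exists (Num.sqrt (\sum_(i < n) M ^+ 2)), M, G; split=> //; split=> //.
- by move=> w; rewrite mulr_ge0// le_max lexx orbT.
- apply: dominated_integrable (integrable_norm ig) _ => // w.
  rewrite /G normrM indicE /=; case: (w \in B); last by rewrite normr0 mul0r normr_ge0.
  by rewrite normr1 mul1r; case: (leP (g w) 0) => gw; rewrite ?normr0.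
- rewrite -(mvk_int1 HH) /Rintegral; congr fine; apply: integral_eq_ae.
  by apply: (@filterS _ _ aeF) HG => w ->.
- move=> w; rewrite /G mulf_eq0 negb_or indicE => /andP[+ _].
  case: (boolP (w \in B)) => [|_]; last by rewrite eqxx.
  rewrite inE => -[Bx Bt] _; split; first by move: Bt; rewrite /= in_itv.
  rewrite /enorm ler_wsqrtr// ler_sum// => i _.
  have := Bx i; rewrite /= in_itv/= -ler_norml => h.
  by rewrite -real_normK ?num_real// lerXn2r// nnegrE.
move=> xi.
have := mvk_mean_value HH openT connected_spacetime (heat_solution_exp_temperature xi)
  (z := (0, 0)) I.
rewrite near_withinE => /nbhs_ballP[d /= d0 hd]; exists d => // r /andP[r0 rd].
have br : ball (0 : R) d r by rewrite -ball_normE /ball_/= sub0r normrN gtr0_norm.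
have [_] := hd r br r0.
rewrite (spacetime_conv_scale _ r0 mG _ HG); last first.
  apply: measurableT_comp => //; apply: measurable_funD.
    exact: (measurable_fun_dotr (measurable_cst xi) measurable_fst).
  exact: (measurable_funM (measurable_cst _) measurable_snd).
move=> h; transitivity (exp_temperature xi (0, 0) : R); last first.
  by rewrite /exp_temperature/= dotrC dotr0l mulr0 addr0 expR0.
rewrite h; apply: eq_Rintegral => w _; congr (_ * expR _).
rewrite /backshift /= !sub0r dotrNr dotrZr; ring.
Qed.

End borel_representative.

(** * Error estimate *)

Section holder.
Context {R : realType} {n : nat} (gamma : R) (f : 'rV[R]_n -> R).
Hypotheses (n0 : (0 < n)%N) (gamma0 : 0 < gamma)
  (hf : holder_continuous gamma f).

Lemma enorm_gt0 (x : 'rV[R]_n) : x != 0 -> 0 < enorm x.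
Proof.
move=> x0; rewrite sqrtr_gt0 lt_neqAle sumr_ge0 ?andbT; last by move=> i _; exact: sqr_ge0.
apply: contraNN x0 => /eqP/esym/eqP; rewrite psumr_eq0 => [/allP h|i _]; last exact: sqr_ge0.
apply/eqP/rowP => i; rewrite mxE; apply/eqP.
by have := h i; rewrite mem_index_enum sqrf_eq0 => /(_ isT).
Qed.

Lemma holder_seminorm_fin :
  exists2 L : R, 0 <= L & holder_seminorm gamma f = L%:E /\
    forall x y, `|f x - f y| <= L * enorm (x - y) `^ gamma.
Proof.
have ub (x y : 'rV[R]_n) : x != y ->
    ((`|f x - f y| / enorm (x - y) `^ gamma)%:E <= holder_seminorm gamma f)%E.
  by move=> xy; apply: ereal_sup_ubound; exists (x, y).
have h0 : (0 <= holder_seminorm gamma f)%E.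
  have x01 : (const_mx 1 : 'rV[R]_n) != 0.
    case: n n0 => // m _; apply/eqP => /rowP/(_ ord0); rewrite !mxE => /eqP.
    by rewrite oner_eq0.
  apply: le_trans (ub _ _ x01).
  by rewrite lee_fin divr_ge0// powR_ge0.
have hfin : holder_seminorm gamma f \is a fin_num by rewrite ge0_fin_numE.
exists (fine (holder_seminorm gamma f)); first exact: fine_ge0.
split=> [|x y]; first by rewrite fineK.
have [->|xy] := eqVneq x y.
  rewrite !subrr normr0 /enorm big1 ?sqrtr0 ?powR0 ?gt_eqF ?mulr0// => i _.
  by rewrite mxE expr0n.
have e0 : 0 < enorm (x - y) `^ gamma by rewrite powR_gt0// enorm_gt0// subr_eq0.
by rewrite -ler_pdivrMr// -lee_fin fineK// ub.
Qed.

End holder.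

Lemma holder_measurable (R : realType) n (gamma L : R) (f : 'rV[R]_n -> R) :
  0 < gamma -> 0 <= L ->
  (forall x y, `|f x - f y| <= L * enorm (x - y) `^ gamma) -> measurable_fun setT f.
Proof.
move=> g0 L0 hf; apply: measurable_continuous_rV => x.
have FF : Filter (nbhs (x : 'rV[R]_n)) by exact: nbhs_filter.
apply/cvgrPdist_le => e e0.
suff h : nbhs (x : 'rV[R]_n) [set y | `|f x - f y| <= e] by exact: h.
pose d0 := (e / (L + 1)) `^ gamma^-1.
have a0 : 0 < e / (L + 1) by rewrite divr_gt0// ltr_wpDl.
have d00 : 0 < d0 by rewrite powR_gt0.
pose d := d0 / Num.sqrt n.+1%:R.
have q0 : 0 < Num.sqrt n.+1%:R :> R by rewrite sqrtr_gt0.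
have dpos : 0 < d by rewrite divr_gt0.
apply/nbhs_ballP; exists d => // y [_ xy].
have le_e : enorm (x - y) <= d0.
  rewrite -(ger0_norm (ltW d00)) -sqrtr_sqr ler_wsqrtr//.
  have -> : d0 ^+ 2 = n.+1%:R * d ^+ 2.
    by rewrite /d exprMn exprVn sqr_sqrtr// mulrC divfK// pnatr_eq0.
  apply: (@le_trans _ _ (\sum_(i < n) d ^+ 2)).
    apply: ler_sum => i _; rewrite !mxE -real_normK ?num_real//.
    by rewrite lerXn2r ?nnegrE ?(ltW dpos)//; apply: ltW; exact: (xy ord0 i).
  by rewrite sumr_const card_ord -[leLHS]mulr_natl ler_wpM2r ?sqr_ge0// ler_nat.
apply: (le_trans (hf x y)).
apply: (@le_trans _ _ (L * (e / (L + 1)))).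
  rewrite ler_wpM2l//.
  have -> : e / (L + 1) = d0 `^ gamma by rewrite /d0 -powRrM mulVf ?gt_eqF// powRr1// ltW.
  by rewrite ge0_ler_powR ?nnegrE ?sqrtr_ge0 ?(ltW g0) ?(ltW d00).
rewrite mulrA ler_pdivrMr ?ltr_wpDl// mulrC ler_wpM2l ?(ltW e0)//; lra.
Qed.

Lemma temperature_bounded (R : realType) n (f : 'rV[R]_n -> R) (M : R) x t :
  measurable_fun setT f -> (forall y, `|f y| <= M) -> 0 <= t ->
  `|temperature f (x, t)| <= M.
Proof.
move=> mf fM; rewrite le_eqVlt => /predU1P[<-|t0]; rewrite /temperature/= ?eqxx// gt_eqF//.
have iW := integrable_weierstrass x t0.
have WM a : `|weierstrass (x - a) t * f a| <= M * weierstrass (x - a) t.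
  by rewrite normrM ger0_norm ?weierstrass_ge0// mulrC ler_wpM2r ?weierstrass_ge0.
have iWf : (lebesgue_rV n).-integrable setT
    (EFin \o (fun a : 'rV[R]_n => weierstrass (x - a) t * f a)).
  apply: dominated_integrable (integrable_scaler M iW) WM.
  apply: measurable_funM => //; apply/measurable_EFinP; exact: (measurable_int _ iW).
apply: (le_trans (le_normr_Rintegral measurableT iWf)).
rewrite -[leRHS]mulr1 -(Rintegral_weierstrass x t0) -RintegralZl//.
apply: le_Rintegral => //; [exact: (integrable_norm iWf)|exact: integrable_scaler].
Qed.

Section error_estimate.
Context {R : realType} {n : nat} (A T : R) (G H : 'rV[R]_n * measurableTypeR R -> R).
Hypotheses (n0 : (0 < n)%N) (KG : borel_kernel A T G).
Hypothesis HG : {ae @spacetime_measure R n, forall w, H w = G w}.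
Context (gamma L r : R) (f : 'rV[R]_n -> R) (w : 'rV[R]_n * measurableTypeR R -> R).
Hypotheses (gamma0 : 0 < gamma) (gamma1 : gamma <= 1) (L0 : 0 <= L) (r0 : 0 < r)
  (hf : forall x y, `|f x - f y| <= L * enorm (x - y) `^ gamma)
  (Sw : is_nonlocal_solution (parabolic_scale r H) f w).
Local Notation spacetime := ('rV[R]_n * measurableTypeR R)%type.
Local Notation mu := (@spacetime_measure R n).
Local Notation A' := (Num.max A 0).
Local Notation theta := (discount G).
Let mf := holder_measurable gamma0 L0 hf.
Let iG := bk_integrable KG.
Let r20 : 0 < r ^+ 2. Proof. exact: exprn_gt0. Qed.
Let wb := past_extension f w.
Let q := L * r `^ gamma * A' `^ gamma.
Let q0 : 0 <= q. Proof. by rewrite !mulr_ge0 ?powR_ge0. Qed.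

Let measurable_wb : measurable_fun setT (wb : spacetime -> R).
Proof.
have [_ cw _] := Sw.
have mh := @measurable_halfspace R n.
rewrite -(setUv (halfspace : set spacetime)); apply/measurable_funU => //.
  exact: measurableC.
split.
  apply: (eq_measurable_fun w); last exact: measurable_within_halfspace.
  by move=> z; rewrite inE /halfspace/= /wb /past_extension ltNge => ->.
apply: (eq_measurable_fun (f \o fst)).
  by move=> z; rewrite inE /halfspace/= /wb /past_extension => /negP; rewrite -ltNge => ->.
by apply: measurable_funTS; exact: (measurableT_comp mf).
Qed.

Let wE z : 0 <= z.2 -> w z = \int[mu]_v (G v * wb (backshift r z v)).
Proof.
move=> z0; have [_ _ ->//] := Sw.
exact: (spacetime_conv_scale z r0 (bk_measurable KG) measurable_wb HG).
Qed.

Let holder_shift x v : G v != 0 -> `|f (x - r *: v.1) - f x| <= q.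
Proof.
move=> /(bk_supp KG)[_ vA]; apply: (le_trans (hf _ _)).
rewrite /q -mulrA ler_wpM2l//.
have -> : x - r *: v.1 - x = - (r *: v.1) by rewrite addrAC subrr add0r.
have -> : enorm (- (r *: v.1)) = r * enorm v.1.
  rewrite -[RHS]ger0_norm ?mulr_ge0 ?sqrtr_ge0 ?(ltW r0)//.
  rewrite -sqrtr_sqr exprMn enorm_sqr /enorm; congr Num.sqrt.
  by rewrite /dotr mulr_sumr; apply: eq_bigr => i _; rewrite !mxE; ring.
rewrite powRM ?sqrtr_ge0 ?(ltW r0)// ler_wpM2l ?powR_ge0//.
by rewrite ge0_ler_powR ?nnegrE ?sqrtr_ge0 ?(ltW gamma0)// le_max ?vA ?lexx ?orbT.
Qed.

Let integrable_shift x : mu.-integrable setT (EFin \o (fun v => G v * f (x - r *: v.1))).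
Proof.
apply: (kernel_integrable KG (M := `|f x| + q)).
  exact: (measurableT_comp mf (measurableT_comp (@measurable_rV_affine R n r x) measurable_fst)).
move=> v /(holder_shift x) h.
by rewrite -[f (x - _)](subrK (f x)) (le_trans (ler_normD _ _))// addrC lerD2l.
Qed.

(** One average of the datum moves it by at most [q], the oscillation of [f] at
    the distances that the rescaled kernel reaches. *)
Let mean_shift x : `|\int[mu]_v (G v * f (x - r *: v.1)) - f x| <= q.
Proof.
have fE : \int[mu]_v (f x * G v) = f x by rewrite RintegralZl// (bk_int1 KG) mulr1.
have ifG := integrable_scaler (f x) iG.
rewrite -[X in _ - X]fE -RintegralB//.
have iB := integrable_subr (integrable_shift x) ifG.
apply: (le_trans (le_normr_Rintegral measurableT iB)).
rewrite -[leRHS]mulr1 -(bk_int1 KG) -RintegralZl//.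
apply: le_Rintegral => //; [exact: (integrable_norm iB)|exact: integrable_scaler|].
move=> v _; rewrite [f x * _]mulrC -mulrBr normrM ger0_norm ?(bk_ge0 KG)// mulrC.
have [->|Gv] := eqVneq (G v) 0; first by rewrite !mulr0.
by rewrite ler_wpM2r ?(bk_ge0 KG)// holder_shift.
Qed.

(** At time 0 the solution is an average of [f] alone, the time slice being
    null; hence [f] stays within [q] of the bounded function [w (_, 0)]. *)
Let bounded_data : exists2 M, (forall x, `|f x| <= M) & forall z, 0 <= z.2 -> `|w z| <= M.
Proof.
have [[M [_ HM]] _ _] := Sw.
pose Mw := M + 1.
have hw z : 0 <= z.2 -> `|w z| <= Mw by move=> z0; apply: HM => //; rewrite ltrDl.
exists (Mw + q) => [x|z /hw h]; last by rewrite (le_trans h)// lerDl.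
have wx : w (x, 0) = \int[mu]_v (G v * f (x - r *: v.1)).
  rewrite wE// /Rintegral; congr fine; apply: integral_eq_ae.
  have aeF : Filter (almost_everywhere mu) by exact: ae_filter_ringOfSetsType.
  apply: (@filterS _ _ aeF) (@time_slice_negligible R n) => v v2; congr EFin.
  have [->|Gv] := eqVneq (G v) 0; first by rewrite !mul0r.
  congr (_ * _); rewrite /wb /past_extension /backshift/= sub0r oppr_lt0 mulr_gt0//.
  have /(bk_supp KG)[/andP[v0 _] _] := Gv.
  by rewrite lt_neqAle v0 andbT eq_sym; apply/eqP.
have := mean_shift x; rewrite -wx => h.
rewrite -[f x](subKr (w (x, 0))) (le_trans (ler_normB _ _))// lerD//.
exact: hw.
Qed.

Let integrable_wb z :
  mu.-integrable setT (EFin \o (fun v => G v * wb (backshift r z v))).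
Proof.
have [M fM wM] := bounded_data.
apply: (kernel_integrable KG (M := M)).
  exact: (measurableT_comp measurable_wb (measurable_backshift _ _)).
move=> v _; rewrite /wb /past_extension; case: ltP => [_|h]; [exact: fM|exact: wM].
Qed.

(** [w - f], extended by 0 to the past, equals its own average up to the error
    [q] of averaging [f]. *)
Lemma nonlocal_near_datum z : 0 <= z.2 ->
  `|w z - f z.1| <= q / (1 - theta) * expR (z.2 / r ^+ 2).
Proof.
have [M fM wM] := bounded_data.
have side (s : R) : `|s| <= 1 -> forall z, 0 <= z.2 ->
    s * (w z - f z.1) <= q / (1 - theta) * expR (z.2 / r ^+ 2).
  move=> s1 {}z z0; pose D (y : spacetime) := s * (wb y - f y.1).
  have DE y : 0 <= y.2 -> D y = s * (w y - f y.1).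
    by move=> y0; rewrite /D /wb /past_extension ltNge y0.
  have FE y : (fun v => G v * D (backshift r y v)) =
     (fun v => s * (G v * wb (backshift r y v)) - s * (G v * f (y.1 - r *: v.1))).
    by apply/funext => v; rewrite /D /=; ring.
  have := @comparison R n A T G KG D r 0 (M + M) q r0 q0.
  rewrite -DE// -[X in X / r ^+ 2](subr0 z.2); apply => //.
  - move=> y y0; rewrite DE// (le_trans (ler_norm _))// normrM.
    apply: (@le_trans _ _ (`|w y - f y.1|)); first by rewrite ler_piMl.
    by rewrite (le_trans (ler_normB _ _))// lerD ?fM ?wM.
  - by move=> y y0; rewrite /D /wb /past_extension y0 subrr mulr0.
  - move=> y y0; rewrite FE; apply: integrable_subr; apply: integrable_scaler.
      exact: integrable_wb.
    exact: integrable_shift.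
  move=> y y0; rewrite FE RintegralB//; last 2 first.
  - exact/integrable_scaler/integrable_wb.
  - exact/integrable_scaler/integrable_shift.
  rewrite (RintegralZl _ measurableT (integrable_wb y)).
  rewrite (RintegralZl _ measurableT (integrable_shift y.1)).
  rewrite -wE// DE// -lerBlDr.
  set I := \int[mu]__ _.
  have -> : s * (w y - f y.1) - (s * w y - s * I) = s * (I - f y.1) by ring.
  rewrite (le_trans (ler_norm _))// normrM.
  apply: (@le_trans _ _ (`|I - f y.1|)); first by rewrite ler_piMl.
  exact: mean_shift.
move=> z0; apply/ler_normlP; split.
  by have := side (-1); rewrite normrN normr1 => /(_ (lexx _) z z0); rewrite mulN1r.
by have := side 1; rewrite normr1 => /(_ (lexx _) z z0); rewrite mul1r.
Qed.

(** The first summand comes from [w] and the second from the temperature, both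
    compared with [f] up to the time [(T + 1) * r ^+ 2]. *)
Definition error_constant : R :=
  A' `^ gamma / (1 - theta) * expR (T + 1) + (1 + 8 * Num.sqrt 2 ^+ n * (T + 1)).

(** In the initial strip [w] and the temperature are both compared with [f].
    Later, [w] minus the temperature equals its own average, so that the bound
    [kappa] propagates by comparison without loss. *)
Lemma error_bound z : 0 <= z.2 ->
  `|w z - temperature f z| <= error_constant * L * r `^ gamma.
Proof.
have T0 := kernel_height_ge0 KG.
have th0 : 0 < 1 - theta by rewrite subr_gt0 (discount_lt1 KG).
set kappa := error_constant * L * r `^ gamma.
(* Above T r^2 the temperature is reproduced; T + 1 makes the bound strict. *)
pose t0 := (T + 1) * r ^+ 2.
have t00 : 0 < t0 by rewrite mulr_gt0// ltr_wpDl.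
have strip y : 0 <= y.2 -> y.2 <= t0 -> `|w y - temperature f y| <= kappa.
  move=> y0 yt.
  have h1 := nonlocal_near_datum y0.
  have h2 := temperature_near_datum gamma0 gamma1 mf hf y.1 n0 y0 r0.
  rewrite -surjective_pairing in h2.
  have -> : w y - temperature f y = (w y - f y.1) - (temperature f y - f y.1) by ring.
  apply: (le_trans (ler_normB _ _)).
  have -> : kappa = q / (1 - theta) * expR (T + 1) +
      L * r `^ gamma * (1 + 8 * Num.sqrt 2 ^+ n * (T + 1)).
    by rewrite /kappa /error_constant /q; field; exact: lt0r_neq0.
  have yT : y.2 / r ^+ 2 <= T + 1 by rewrite ler_pdivrMr.
  apply: lerD.
    apply: (le_trans h1); rewrite ler_wpM2l ?ler_expR//.
    by rewrite mulr_ge0// invr_ge0 ltW.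
  apply: (le_trans h2); rewrite ler_wpM2l ?mulr_ge0 ?powR_ge0// lerD2l.
  by rewrite -mulrA ler_wpM2l// mulr_ge0// exprn_ge0// sqrtr_ge0.
have [M fM wM] := bounded_data.
have side (s : R) : `|s| <= 1 -> forall z, t0 <= z.2 ->
    s * (w z - temperature f z) <= kappa.
  move=> s1 {}z zt.
  (* At negative times the formula for the temperature is meaningless; any
     nonpositive value serves, the averages at times >= t0 never reaching it. *)
  pose D (y : spacetime) := if y.2 < 0 then 0 else s * (w y - temperature f y) - kappa.
  have Dpos y : 0 <= y.2 -> D y = s * (w y - temperature f y) - kappa.
    by move=> y0; rewrite /D ltNge y0.
  have sle y : s * (w y - temperature f y) <= `|w y - temperature f y|.
    by rewrite (le_trans (ler_norm _))// normrM ler_piMl.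
  have FE y : t0 <= y.2 -> (fun v => G v * D (backshift r y v)) =
     (fun v => s * (G v * wb (backshift r y v))
       - s * (G v * temperature f (backshift r y v)) - kappa * G v).
    move=> yt; apply/funext => v.
    have [->|Gv] := eqVneq (G v) 0; first by rewrite !mul0r !mulr0 !subr0.
    have /(bk_supp KG)[/andP[_ vT] _] := Gv.
    have b0 : 0 <= (backshift r y v).2.
      rewrite /backshift/= subr_ge0 (le_trans _ yt)// /t0 mulrC ler_wpM2r ?(ltW r20)//.
      by rewrite (le_trans vT)// lerDl.
    by rewrite Dpos// /wb /past_extension ltNge b0/=; ring.
  have iD y : t0 <= y.2 ->
     mu.-integrable setT (EFin \o (fun v => G v * temperature f (backshift r y v))) /\
     \int[mu]_v (G v * temperature f (backshift r y v)) = temperature f y.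
    move=> yt; have Ty : T * r ^+ 2 < y.2.
      by rewrite (lt_le_trans _ yt)// ltr_pM2r// ltrDl.
    by have := kernel_temperature KG y.1 mf fM r0 Ty; rewrite -surjective_pairing.
  have iwb y := integrable_scaler s (integrable_wb y).
  have ik := integrable_scaler kappa iG.
  have := @comparison R n A T G KG D r t0 (M + M - kappa) 0 r0 (lexx _).
  rewrite mul0r => /(_ _ _ _ _ z zt); rewrite mul0r Dpos ?(le_trans (ltW t00))// subr_le0.
  apply.
  - move=> y yt; have y0 := le_trans (ltW t00) yt; rewrite Dpos// lerB//.
    rewrite (le_trans (sle y))// (le_trans (ler_normB _ _))// lerD ?wM//.
    by have := temperature_bounded y.1 mf fM y0; rewrite -surjective_pairing.
  - move=> y yt; rewrite /D; case: ltP => // y0.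
    by rewrite subr_le0 (le_trans (sle y))// strip// ltW.
  - move=> y yt; rewrite (FE y yt); have [/(integrable_scaler s) iu _] := iD y yt.
    by apply: integrable_subr => //; exact: integrable_subr.
  move=> y yt; rewrite (FE y yt); have [iu ue] := iD y yt.
  have isu := integrable_scaler s iu.
  have y0 := le_trans (ltW t00) yt.
  rewrite add0r (RintegralB measurableT (integrable_subr (iwb y) isu) ik).
  rewrite (RintegralB measurableT (iwb y) isu).
  rewrite (RintegralZl _ measurableT (integrable_wb y)) (RintegralZl _ measurableT iu).
  rewrite (RintegralZl _ measurableT iG).
  by rewrite ue -wE// (bk_int1 KG) mulr1 Dpos// mulrBr.
move=> z0; have [zt|zt] := leP t0 z.2; last exact: strip (ltW zt).
apply/ler_normlP; split.
  by have := side (-1); rewrite normrN normr1 => /(_ (lexx _) z zt); rewrite mulN1r.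
by have := side 1; rewrite normr1 => /(_ (lexx _) z zt); rewrite mul1r.
Qed.

End error_estimate.

Theorem theorem4 (R : realType) (n : nat) (n_gt0 : (0 < n)%N)
    (gamma : R) (gamma_gt0 : 0 < gamma) (gamma_le1 : gamma <= 1)
    (H : 'rV[R]_n * R -> R) (HH : mean_value_kernel H) :
  exists C : R, 0 < C /\
    forall (r : R), 0 < r ->
    forall f : 'rV[R]_n -> R,
      holder_continuous gamma f -> f \in Lfun (lebesgue_rV n) +oo%E ->
    forall w : 'rV[R]_n * R -> R,
      is_nonlocal_solution (parabolic_scale r H) f w ->
      (halfspace_Linfty (w \- temperature f)%R
        <= C%:E * holder_seminorm gamma f * (r `^ gamma)%:E)%E.
Proof.
have [A [T [G [KG HG]]]] := mean_value_kernel_borel HH.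
have T0 := kernel_height_ge0 KG.
have C0 : 0 < @error_constant R n A T G gamma.
  rewrite /error_constant ltr_wpDl//.
    rewrite !mulr_ge0 ?powR_ge0 ?expR_ge0 ?invr_ge0 ?subr_ge0//.
    exact: (ltW (discount_lt1 KG)).
  by rewrite ltr_pwDl// !mulr_ge0 ?exprn_ge0 ?sqrtr_ge0 ?addr_ge0.
exists (error_constant A T G gamma); split=> // r r0 f hf _ w Sw.
have [L L0 [-> Lf]] := holder_seminorm_fin n_gt0 gamma_gt0 hf.
rewrite -!EFinM /halfspace_Linfty Lnorm.unlock.
have K0 : 0 <= error_constant A T G gamma * L * r `^ gamma.
  by rewrite !mulr_ge0 ?powR_ge0 ?(ltW C0).
case: ifP => _; last by rewrite lee_fin.
apply/ess_supP; apply: nearW => z; rewrite /= lee_fin patchE.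
case: ifPn => [|_]; last by rewrite normr0.
by rewrite inE => z0; exact: (error_bound n_gt0 KG HG gamma_gt0 gamma_le1 L0 r0 Lf Sw).
Qed.
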